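(* Let $\mathcal{G}$ be a minimal effective étale groupoid over a space $X$ which is either a Cantor space or a locally compact, non-compact Cantor space. (i) If $X$ is a Cantor space, the only non-trivial uniformly recurrent subgroup of the group $\mathsf{A}(\mathcal{G})$ is the stabiliser URS associated to the action $\mathsf{A}(\mathcal{G})\curvearrowright X$. (ii) If $X$ is a locally compact, non-compact Cantor space, then the group $\mathsf{A}(\mathcal{G})$ has no non-trivial uniformly recurrent subgroups.
   Context: A Cantor space is a space homeomorphic to the Cantor set; a locally compact, non-compact Cantor space is a space homeomorphic to an open, non-closed subset of the Cantor set. An étale groupoid over a Hausdorff space $X$ is a topological groupoid $\mathcal{G}$ (not necessarily Hausdorff) with unit space $X\subset\mathcal{G}$ whose source and range maps $\mathsf{s},\mathsf{r}\colon\mathcal{G}\to X$ are open local homeomorphisms. The orbit of $x$ is $\mathsf{r}(\mathsf{s}^{-1}(x))$; $\mathcal{G}$ is minimal if every orbit is dense. A bisection is an open $T\subset\mathcal{G}$ such that $\mathsf{s}|_T,\mathsf{r}|_T$ are homeomorphisms onto their images; it induces the homeomorphism $\tau(T)=\mathsf{r}|_T\circ(\mathsf{s}|_T)^{-1}\colon\mathsf{s}(T)\to\mathsf{r}(T)$. $\mathcal{G}$ is effective if every bisection is determined by its homeomorphism $\tau(T)$. The full group $\mathsf{F}(\mathcal{G})$ is the group of bisections $g$ with $\mathsf{s}(g)=\mathsf{r}(g)=X$ (identified with the homeomorphisms $\tau(g)$ of $X$). $\mathsf{A}(\mathcal{G})\le\mathsf{F}(\mathcal{G})$ is the subgroup generated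 by all 3-cycles, i.e. elements $g\in\mathsf{F}(\mathcal{G})$ of order 3 for which there are disjoint compact open sets $U_1,U_2,U_3\subset X$ with $g(U_1)=U_2$, $g(U_2)=U_3$, $g(U_3)=U_1$ and $g$ the identity outside $U_1\cup U_2\cup U_3$. For a group $G$, $\mathrm{Sub}(G)$ is the compact space of subgroups of $G$ with the Chabauty topology (induced from the product topology on $\{0,1\}^G$), on which $G$ acts by conjugation. A uniformly recurrent subgroup (URS) of $G$ is a closed minimal conjugation-invariant subset of $\mathrm{Sub}(G)$; it is trivial if it is $\{\{1\}\}$ or $\{G\}$. If $G\curvearrowright X$ is a minimal action on a compact space, the closure of $\{\mathrm{St}_G(x)\colon x\in X\}$ in $\mathrm{Sub}(G)$ contains a unique URS, called the stabiliser URS of the action. *)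

(* Defs.v *)
From HB Require Import structures.
From mathcomp Require Import all_boot.
From mathcomp Require Import all_classical topology cantor.

Set Implicit Arguments.
Unset Strict Implicit.
Unset Printing Implicit Defensive.

Local Open Scope classical_set_scope.
Local Open Scope group_scope.

Definition homeomorphic (Y Z : topologicalType) : Prop :=
  exists (f : Y -> Z) (h : Z -> Y),
    [/\ cancel f h, cancel h f, continuous f & continuous h].

Definition is_cantor_space (Y : topologicalType) : Prop :=
  homeomorphic Y cantor_space.

(* [set_type U] carries the topology induced from [cantor_space]. *)
Definition is_lc_noncompact_cantor_space (Y : topologicalType) : Prop :=
  exists U : set cantor_space,
    [/\ open U, ~ closed U & homeomorphic Y (set_type U)].

(* The restriction of [f] to [A] is a homeomorphism onto [f @` A]; only the
   values of [h] on [f @` A] matter. *)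
Definition homeomorphism_on (Y Z : topologicalType) (A : set Y) (f : Y -> Z) :
    Prop :=
  {within A, continuous f} /\
  exists h : Z -> Y, {in A, cancel f h} /\ {within f @` A, continuous h}.

Definition local_homeomorphism (Y Z : topologicalType) (f : Y -> Z) : Prop :=
  forall y : Y, exists U : set Y,
    [/\ open U, U y, open (f @` U) & homeomorphism_on U f].

(* The inclusion of the unit space is [gunit]: since it is continuous with
   continuous left inverse [src], X carries the topology induced from the
   groupoid.  The product [gmul g h] is meaningful only when [src g = rng h];
   all its axioms, continuity included, are restricted to such pairs.  The
   topology of the groupoid itself is not assumed to be Hausdorff. *)
Record etale_groupoid (X : topologicalType) := EtaleGroupoid {
  arrow :> topologicalType;
  gunit : X -> arrow;
  src : arrow -> X;
  rng : arrow -> X;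
  gmul : arrow -> arrow -> arrow;
  ginv : arrow -> arrow;

  src_unit : forall x, src (gunit x) = x;
  rng_unit : forall x, rng (gunit x) = x;
  src_mul : forall g h, src g = rng h -> src (gmul g h) = src h;
  rng_mul : forall g h, src g = rng h -> rng (gmul g h) = rng g;
  gmulA : forall g h k, src g = rng h -> src h = rng k ->
    gmul g (gmul h k) = gmul (gmul g h) k;
  gmul1 : forall g, gmul g (gunit (src g)) = g;
  gmul1l : forall g, gmul (gunit (rng g)) g = g;
  src_inv : forall g, src (ginv g) = rng g;
  rng_inv : forall g, rng (ginv g) = src g;
  gmulV : forall g, gmul g (ginv g) = gunit (rng g);
  gmulVl : forall g, gmul (ginv g) g = gunit (src g);

  unit_space_hausdorff : hausdorff_space X;
  gunit_continuous : continuous gunit;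
  src_continuous : continuous src;
  rng_continuous : continuous rng;
  ginv_continuous : continuous ginv;
  gmul_continuous :
    {within [set p : arrow * arrow | src p.1 = rng p.2],
       continuous (fun p : arrow * arrow => gmul p.1 p.2)};

  src_open : forall U : set arrow, open U -> open (src @` U);
  rng_open : forall U : set arrow, open U -> open (rng @` U);
  src_local_homeo : local_homeomorphism src;
  rng_local_homeo : local_homeomorphism rng
}.

Arguments gunit {X} _ _.
Arguments src {X e} _.
Arguments rng {X e} _.
Arguments ginv {X e} _.

Section Groupoid.
Context {X : topologicalType} (G : etale_groupoid X).
Implicit Types (g h k : G) (x : X) (T : set G).

Definition groupoid_orbit x : set X := rng @` [set g : G | src g = x].

Definition minimal_groupoid : Prop := forall x, dense (groupoid_orbit x).

Definition bisection T : Prop :=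
  [/\ open T, homeomorphism_on T (src : G -> X) & homeomorphism_on T (rng : G -> X)].

(* On [src @` T] this is the map rng|T o (src|T)^-1 : src(T) -> rng(T);
   elsewhere it takes the junk value x. *)
Definition tau T x : X := rng (xget (gunit G x) [set g | T g /\ src g = x]).

Definition effective_groupoid : Prop :=
  forall T1 T2, bisection T1 -> bisection T2 ->
    src @` T1 = src @` T2 ->
    (forall x, (src @` T1) x -> tau T1 x = tau T2 x) ->
    T1 = T2.

Definition full_bisection T : Prop :=
  [/\ bisection T, src @` T = [set: X] & rng @` T = [set: X]].

Definition bis_one : set G := range (gunit G).
Definition bis_mul T1 T2 : set G :=
  [set k | exists g h, [/\ T1 g, T2 h, src g = rng h & k = gmul g h]].
Definition bis_inv T : set G := ginv @` T.

Lemma ginvK g : ginv (ginv g) = g.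
Proof.
rewrite -[LHS]gmul1 src_inv rng_inv -(gmulVl g) gmulA ?src_inv ?rng_inv//.
by rewrite gmulVl src_inv gmul1l.
Qed.

Lemma bis_invE T g : bis_inv T g <-> T (ginv g).
Proof.
by split=> [[h Th <-]|Tg]; [rewrite ginvK|exists (ginv g); rewrite ?ginvK].
Qed.

Lemma within_comp (Y Z W : topologicalType) (A : set Z) (f : Z -> W)
    (h : Y -> Z) :
  {within A, continuous f} -> continuous h -> (forall y, A (h y)) ->
  continuous (fun y => f (h y)).
Proof.
move=> /subspace_continuousP cf ch hA y V /(cf _ (hA y)) fV.
have := ch y _ fV; rewrite /= /nbhs /=; apply: filterS => z /=; exact.
Qed.

Lemma gmul_continuous2 (Y : topologicalType) (a b : Y -> G) :
  continuous a -> continuous b -> (forall y, src (a y) = rng (b y)) ->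
  continuous (fun y => gmul (a y) (b y)).
Proof.
move=> ca cb ab.
apply: (within_comp (@gmul_continuous X G) (h := fun y => (a y, b y))) => //.
by move=> y; apply: cvg_pair; [exact: ca|exact: cb].
Qed.

Lemma full_bisectionP T : full_bisection T <->
  open T /\ exists hs hr : X -> G,
   [/\ continuous hs /\ continuous hr,
       forall x, T (hs x) /\ src (hs x) = x,
       forall x, T (hr x) /\ rng (hr x) = x,
       forall g, T g -> hs (src g) = g &
       forall g, T g -> hr (rng g) = g].
Proof.
split=> [[[oT [_ [hs [hsK chs]]] [_ [hr [hrK chr]]]] sT rT]|].
  split=> //; exists hs, hr; move: chs chr; rewrite sT rT.
  move=> /(continuous_subspace_setT _).2 chs /(continuous_subspace_setT _).2 chr.
  have Ks g : T g -> hs (src g) = g by move=> Tg; apply: hsK; rewrite inE.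
  have Kr g : T g -> hr (rng g) = g by move=> Tg; apply: hrK; rewrite inE.
  split=> // x.
    have [g Tg <-] : (src @` T) x by rewrite sT.
    by rewrite Ks.
  have [g Tg <-] : (rng @` T) x by rewrite rT.
  by rewrite Kr.
case=> oT [hs [hr [[chs chr] hsT hrT Ks Kr]]].
have sT : src @` T = [set: X].
  by rewrite -subTset => x _; exists (hs x); have [] := hsT x.
have rT : rng @` T = [set: X].
  by rewrite -subTset => x _; exists (hr x); have [] := hrT x.
split=> //; split=> //; split.
- exact/continuous_subspaceT/src_continuous.
- exists hs; rewrite sT; split; last exact: ((continuous_subspace_setT _).1 chs).
  by move=> g; rewrite inE => /Ks.
- exact/continuous_subspaceT/rng_continuous.
- exists hr; rewrite rT; split; last exact: ((continuous_subspace_setT _).1 chr).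
  by move=> g; rewrite inE => /Kr.
Qed.

Lemma bis_one_full : full_bisection bis_one.
Proof.
apply/full_bisectionP; split.
  rewrite openE => _ [x _ <-]; rewrite /interior.
  have [U [oU Ux _ [_ [h [hK _]]]]] := src_local_homeo (gunit G x).
  have nU : nbhs (gunit G x) U by exact: open_nbhs_nbhs.
  have nV : nbhs (gunit G x) [set g | U (gunit G (src g))].
    apply: (@src_continuous X G (gunit G x)
      [set y | U (gunit G y)]).
    by apply: gunit_continuous; rewrite src_unit.
  apply: filterS2 nU nV => g /= Ug Usg.
  exists (src g) => //.
  by rewrite -[LHS]hK ?inE// src_unit hK ?inE.
exists (gunit G), (gunit G); split.
- by split; exact: gunit_continuous.
- by move=> x; rewrite src_unit; split=> //; exists x.
- by move=> x; rewrite rng_unit; split=> //; exists x.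
- by move=> _ [x _ <-]; rewrite src_unit.
- by move=> _ [x _ <-]; rewrite rng_unit.
Qed.

Lemma bis_mul_full T1 T2 :
  full_bisection T1 -> full_bisection T2 -> full_bisection (bis_mul T1 T2).
Proof.
move=> /full_bisectionP[o1 [s1 [r1 [[cs1 cr1] s1T r1T Ks1 Kr1]]]].
move=> /full_bisectionP[o2 [s2 [r2 [[cs2 cr2] s2T r2T Ks2 Kr2]]]].
apply/full_bisectionP.
have compr k : src (ginv (r1 (rng k))) = rng k.
  by rewrite src_inv (proj2 (r1T _)).
pose d (k : G) := gmul (ginv (r1 (rng k))) k.
have rd k : rng (d k) = src (r1 (rng k)) by rewrite rng_mul ?rng_inv.
have mulE : bis_mul T1 T2 = d @^-1` T2.
  apply/seteqP; split=> k /=.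
    move=> [g [h [Tg Th gh ->]]]; rewrite /d rng_mul// Kr1//.
    by rewrite gmulA ?src_inv// gmulVl gh gmul1l.
  move=> Td; exists (r1 (rng k)), (d k); split=> //.
  - by have [] := r1T (rng k).
  - rewrite /d gmulA ?rng_inv ?src_inv ?(proj2 (r1T _))// gmulV.
    by rewrite (proj2 (r1T _)) gmul1l.
have cd : continuous d.
  apply: gmul_continuous2 => //.
    move=> k; apply: (@continuous_comp _ _ _ (fun k => r1 (rng k))).
      apply: continuous_comp; [exact: rng_continuous|exact: cr1].
    exact: ginv_continuous.
  by move=> k; exact: cvg_id.
split; first by rewrite mulE; apply: open_comp => // k _; exact: cd.
exists (fun x => gmul (s1 (rng (s2 x))) (s2 x)).
exists (fun x => gmul (r1 x) (r2 (src (r1 x)))).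
split.
- split.
    apply: gmul_continuous2 => // [x|x]; last by have [] := s1T (rng (s2 x)).
    apply: (@continuous_comp _ _ _ (fun x => rng (s2 x))); last exact: cs1.
    apply: continuous_comp; [exact: cs2|exact: rng_continuous].
  apply: gmul_continuous2 => // [x|x]; last by have [] := r2T (src (r1 x)).
  apply: (@continuous_comp _ _ _ (fun x => src (r1 x))); last exact: cr2.
  apply: continuous_comp; [exact: cr1|exact: src_continuous].
- move=> x; have [T1s e1] := s1T (rng (s2 x)); have [T2s e2] := s2T x.
  by rewrite src_mul//; split=> //; exists (s1 (rng (s2 x))), (s2 x).
- move=> x; have [T1r e1] := r1T x; have [T2r e2] := r2T (src (r1 x)).
  by rewrite rng_mul//; split=> //; exists (r1 x), (r2 (src (r1 x))).
- by move=> _ [g [h [Tg Th gh ->]]]; rewrite src_mul// Ks2// -gh Ks1.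
- by move=> _ [g [h [Tg Th gh ->]]]; rewrite rng_mul// Kr1// gh Kr2.
Qed.

Lemma bis_inv_full T : full_bisection T -> full_bisection (bis_inv T).
Proof.
move=> /full_bisectionP[oT [hs [hr [[cs cr] sT rT Ks Kr]]]].
apply/full_bisectionP; split.
  have -> : bis_inv T = (ginv : G -> G) @^-1` T.
    by apply/seteqP; split=> g /bis_invE.
  by apply: open_comp => // g _; exact: ginv_continuous.
exists (fun x => ginv (hr x)), (fun x => ginv (hs x)); split.
- by split=> x; apply: continuous_comp; (exact: cs || exact: cr ||
    exact: ginv_continuous).
- by move=> x; have [? e] := rT x; rewrite src_inv; split=> //; exists (hr x).
- by move=> x; have [? e] := sT x; rewrite rng_inv; split=> //; exists (hs x).
- by move=> _ [g Tg <-]; rewrite src_inv Kr.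
- by move=> _ [g Tg <-]; rewrite rng_inv Ks.
Qed.

Lemma full_src_inj T g h :
  full_bisection T -> T g -> T h -> src g = src h -> g = h.
Proof.
move=> /full_bisectionP[_ [hs [_ [_ _ _ Ks _]]]] Tg Th e.
by rewrite -(Ks g)// e Ks.
Qed.

Lemma full_rng_inj T g h :
  full_bisection T -> T g -> T h -> rng g = rng h -> g = h.
Proof.
move=> /full_bisectionP[_ [_ [hr [_ _ _ _ Kr]]]] Tg Th e.
by rewrite -(Kr g)// e Kr.
Qed.

Lemma tauE T g : full_bisection T -> T g -> tau T (src g) = rng g.
Proof.
move=> fT Tg; rewrite /tau; case: xgetP => [h _ [Th e]|/(_ g)[]//].
by rewrite (full_src_inj fT Th Tg e).
Qed.

End Groupoid.

Definition full_group (X : topologicalType) (G : etale_groupoid X) : Type :=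
  set_type [set T : set G | full_bisection T].

Section FullGroup.
Context {X : topologicalType} (G : etale_groupoid X).

HB.instance Definition _ :=
  SubChoice.copy (full_group G) (set_type [set T : set G | full_bisection T]).

Lemma full_groupP (a : full_group G) : full_bisection (val a).
Proof. exact: (set_mem (valP a)). Qed.

Definition full_of (T : set G) (fT : full_bisection T) : full_group G :=
  exist _ T (mem_set fT).

Definition full_one := full_of (bis_one_full G).
Definition full_mul (a b : full_group G) :=
  full_of (bis_mul_full (full_groupP a) (full_groupP b)).
Definition full_inv (a : full_group G) :=
  full_of (bis_inv_full (full_groupP a)).

Fact full_mulA : associative full_mul.
Proof.
move=> a b c; apply/val_inj/seteqP; split=> k /=.
  move=> [g [_ [ag [h [l [bh cl hl ->]]] gh ->]]]; rewrite rng_mul// in gh.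
  exists (gmul g h), l; rewrite gmulA// src_mul//; split=> //.
  by exists g, h.
move=> [_ [l [[g [h [ag bh gh ->]]] cl hl ->]]]; rewrite src_mul// in hl.
exists g, (gmul h l); rewrite gmulA// rng_mul//; split=> //.
by exists h, l.
Qed.

Fact full_mul1 : left_id full_one full_mul.
Proof.
move=> a; apply/val_inj/seteqP; split=> k /=.
  move=> [_ [h [[x _ <-] ah + ->]]]; rewrite src_unit => ->.
  by rewrite gmul1l.
move=> ak; exists (gunit G (rng k)), k; rewrite gmul1l src_unit.
by split=> //; exists (rng k).
Qed.

Fact full_mulr1 : right_id full_one full_mul.
Proof.
move=> a; apply/val_inj/seteqP; split=> k /=.
  move=> [g [_ [ag [x _ <-] + ->]]]; rewrite rng_unit => <-.
  by rewrite gmul1.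
move=> ak; exists k, (gunit G (src k)); rewrite gmul1 rng_unit.
by split=> //; exists (src k).
Qed.

Fact full_mulV : left_inverse full_one full_inv full_mul.
Proof.
move=> a; apply/val_inj/seteqP; split=> k /=.
  move=> [_ [h [[g ag <-] ah + ->]]]; rewrite src_inv.
  by move=> /(full_rng_inj (full_groupP a) ag ah) ->; rewrite gmulVl; exists (src h).
move=> [x _ <-].
have [_ /seteqP[_ /(_ x I)[g ag gx]] _] := full_groupP a.
exists (ginv g), g; rewrite src_inv gmulVl gx; split=> //.
by exists g.
Qed.

Fact full_mulrV : right_inverse full_one full_inv full_mul.
Proof.
move=> a; apply/val_inj/seteqP; split=> k /=.
  move=> [g [_ [ag [h ah <-] + ->]]]; rewrite rng_inv.
  by move=> /(full_src_inj (full_groupP a) ag ah) ->; rewrite gmulV; exists (rng h).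
move=> [x _ <-].
have [_ _ /seteqP[_ /(_ x I)[g ag gx]]] := full_groupP a.
exists g, (ginv g); rewrite rng_inv gmulV gx; split=> //.
by exists g.
Qed.

HB.instance Definition _ := isGroup.Build (full_group G)
  full_mulA full_mul1 full_mulr1 full_mulV full_mulrV.

Lemma tau1 x : tau (val (1 : full_group G)) x = x.
Proof.
rewrite -{1}(src_unit G x) (tauE (full_groupP _)) ?rng_unit//.
by exists x.
Qed.

Lemma tauM (a b : full_group G) x :
  tau (val (a * b)) x = tau (val a) (tau (val b) x).
Proof.
have [_ /seteqP[_ /(_ x I)[h bh <-]] _] := full_groupP b.
have [_ /seteqP[_ /(_ (rng h) I)[g ag gx]] _] := full_groupP a.
rewrite (tauE (full_groupP b) bh) -gx (tauE (full_groupP a) ag).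
rewrite -(src_mul gx) (tauE (full_groupP _)) ?rng_mul//.
by exists g, h.
Qed.

End FullGroup.

Section Alternating.
Context {X : topologicalType} (G : etale_groupoid X).

Definition is_3cycle (a : full_group G) : Prop :=
  [/\ a <> 1, a ^+ 3 = 1 &
   exists U1 U2 U3 : set X,
    [/\ [/\ compact U1, compact U2 & compact U3],
        [/\ open U1, open U2 & open U3],
        [/\ U1 `&` U2 = set0, U2 `&` U3 = set0 & U1 `&` U3 = set0],
        [/\ tau (val a) @` U1 = U2, tau (val a) @` U2 = U3 &
            tau (val a) @` U3 = U1] &
        forall x, ~ (U1 `|` U2 `|` U3) x -> tau (val a) x = x]].

Definition generated_subgroup (gT : groupType) (S : set gT) : set gT :=
  smallest (fun H : set gT => group_closed (mem H)) S.

Lemma generated_subgroup_closed (gT : groupType) (S : set gT) :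
  group_closed (mem (generated_subgroup S)).
Proof.
split=> [|a b]; rewrite !inE.
  by move=> H [/= [H1 _] _]; rewrite inE in H1.
move=> Sa Sb H [/= Hc SH]; have := Hc.2 a b; rewrite !inE.
by apply; [exact: Sa|exact: Sb].
Qed.

Definition alternating_group : Type :=
  set_type (generated_subgroup is_3cycle).

HB.instance Definition _ :=
  SubChoice.copy alternating_group
    (set_type (generated_subgroup is_3cycle)).
HB.instance Definition _ := SubChoice_isSubGroup.Build
  (full_group G) (mem (generated_subgroup is_3cycle)) alternating_group
  (generated_subgroup_closed is_3cycle).

End Alternating.

Record group_action (gT : groupType) (Y : Type) := GroupAction {
  group_act :> gT -> Y -> Y;
  group_act1 : forall y, group_act 1 y = y;
  group_actM : forall a b y, group_act (a * b) y = group_act a (group_act b y)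
}.

Section AlternatingAction.
Context {X : topologicalType} (G : etale_groupoid X).

Definition alternating_act (a : alternating_group G) : X -> X :=
  tau (val (val a)).

Fact alternating_act1 x : alternating_act 1 x = x.
Proof. exact: tau1. Qed.

Fact alternating_actM a b x :
  alternating_act (a * b) x = alternating_act a (alternating_act b x).
Proof. exact: tauM. Qed.

Definition alternating_action : group_action (alternating_group G) X :=
  GroupAction alternating_act1 alternating_actM.

End AlternatingAction.

(* Sub(gT) with the Chabauty topology: a [set_type] of the product space
   {0,1}^gT. *)
Definition subgroup_space (gT : groupType) : topologicalType :=
  set_type [set H : prod_topology (fun _ : gT => bool) |
            group_closed (H : pred gT)].

Section URS.
Context {gT : groupType}.
Implicit Types (H K : subgroup_space gT) (U V : set (subgroup_space gT)).

Definition subgroup_of (H : pred gT) (cH : group_closed H) : subgroup_space gT :=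
  exist _ (H : prod_topology (fun _ : gT => bool)) (mem_set cH).

Fact trivial_closed : group_closed (pred1 (1 : gT)).
Proof. by split=> [|a b]; rewrite !inE// => /eqP-> /eqP->; rewrite divg1. Qed.

Fact whole_closed : group_closed (predT : pred gT).
Proof. by []. Qed.

Definition subgroup_trivial : subgroup_space gT := subgroup_of trivial_closed.
Definition subgroup_whole : subgroup_space gT := subgroup_of whole_closed.

Fact subgroup_conj_closed (a : gT) H :
  group_closed (fun b : gT => val H (b ^ a) : bool).
Proof.
have [H1 Hd] : group_closed (val H : pred gT) := set_mem (valP H).
split=> [|b c Hb Hc]; first by rewrite unfold_in conj1g; exact: H1.
by rewrite unfold_in conjMg conjVg; exact: Hd.
Qed.

(* a H a^-1, as b is in a H a^-1 iff b ^ a = a^-1 b a is in H. *)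
Definition subgroup_conj (a : gT) H : subgroup_space gT :=
  subgroup_of (subgroup_conj_closed a H).

Definition conj_invariant U : Prop :=
  forall a H, U H -> U (subgroup_conj a H).

Definition is_URS U : Prop :=
  [/\ closed U, U !=set0, conj_invariant U &
   forall V, closed V -> V !=set0 -> conj_invariant V -> V `<=` U -> V = U].

Definition trivial_URS U : Prop :=
  U = [set subgroup_trivial] \/ U = [set subgroup_whole].

Section Stabiliser.
Context {Y : Type} (to : group_action gT Y).

Fact stabiliser_closed (y : Y) :
  group_closed (fun a : gT => `[< to a y = y >] : bool).
Proof.
split=> [|a b]; rewrite !unfold_in; first by apply/asboolP; exact: group_act1.
move=> /asboolP ay /asboolP bfix; apply/asboolP.
have bV : to b^-1 y = y by rewrite -{1}bfix -group_actM mulVg group_act1.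
by rewrite group_actM bV.
Qed.

Definition stabiliser (y : Y) : subgroup_space gT :=
  subgroup_of (stabiliser_closed y).

(* The unique URS contained in the closure of the set of point stabilisers. *)
Definition is_stabiliser_URS U : Prop :=
  let C := closure (range stabiliser) in
  [/\ is_URS U, U `<=` C & forall V, is_URS V -> V `<=` C -> V = U].

End Stabiliser.
End URS.

(* Main.v *)
Require Import Defs.
From mathcomp Require Import all_boot all_classical topology cantor.

Set Implicit Arguments.
Unset Strict Implicit.
Unset Printing Implicit Defensive.

Local Open Scope classical_set_scope.
Local Open Scope group_scope.

(** Let A be the alternating group, acting on the unit space X, and let V be
    a uniformly recurrent subgroup of A other than {{1}} and {A}.

    Since V is closed and does not contain the trivial subgroup, a finite set P
    of nontrivial elements meets every conjugate of every member H of V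
    ([URS_confined]).  Such a confined subgroup H is large: there is a finite
    set Q of points such that every finite set disjoint from Q has a
    neighbourhood U for which H contains the commutators of the elements
    supported in U ([finite_exceptional]).  Otherwise there would be many
    disjoint finite sets F violating this, each with a commutator of elements
    sigma, rho supported near F and lying outside H.  Products x of choices of
    these sigma and rho form a large grid.  For every x, and for each of several
    translates p' of P into general position, H contains a conjugate by x of
    some element of p'; this colours the grid, and a pigeonhole argument yields
    points of the same colour that differ in one direction only.  Quotients of
    the corresponding elements of H act near the sets F as known elements, and
    the rest of their supports are disjoint for different translates; so a
    commutator of two such quotients is one of the commutators outside H, a
    contradiction ([colouring_core]).  As a small 3-cycle is a commutator of
    elements with small support, H contains every 3-cycle fixing Q pointwise
    ([good_cyc_off]).

    Elements of A move Q into any nonempty open set, so limits of conjugates of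
    H give a member K of V containing all 3-cycles that are trivial on some set
    of a prescribed directed family of open sets ([URS_directed]).  If X is not
    compact, push Q to infinity: K contains all 3-cycles, hence K = A and
    V = {A}.  If X is compact, push Q to a point x: K contains all 3-cycles
    fixing x.  They generate the group of all elements that are trivial near x
    ([cycles_off_of_germ]), and together with any element moving x they generate
    A ([subgroup_off_whole]); so K lies between the germ stabiliser and the
    stabiliser of x.

    These two groups have the same trace on a finite subset s of A, unless x is
    on the boundary of the fixed point set of some element of s, which excludes
    only a nowhere dense set of points.  Hence V contains every limit of
    stabilisers of points that avoid more and more of these boundaries
    ([generic_sub]).  These limits form a closed invariant set independent of V,
    which by minimality equals V; the same argument shows that it is the
    stabiliser URS.  Working with finite traces replaces the Baire category
    theorem, which would require A to be countable.

    The action of A enters only through [rich_action]: there are enough 3-cycles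
    to move points and to realise germs, and they can be restricted to smaller
    sets.  [alternating_rich] derives this from minimality and effectiveness. *)

(** * Finite sets of points, 3-cycles and germs *)

Section FinitePoints.
Context {X : topologicalType}.
Implicit Types (x y z : X) (U V W : set X).

Lemma open_forall (I : eqType) (s : seq I) (F : I -> set X) :
  (forall i, i \in s -> open (F i)) -> open [set x | forall i, i \in s -> F i x].
Proof.
elim: s => [|i s IH] oF.
  by rewrite (_ : [set _ | _] = setT); [exact: openT|apply/seteqP; split].
rewrite (_ : [set _ | _] = F i `&` [set x | forall i, i \in s -> F i x]).
  apply: openI; first by apply: oF; rewrite mem_head.
  by apply: IH => j js; apply: oF; rewrite inE js orbT.
apply/seteqP; split=> x /=.
  by move=> h; split=> [|j js]; apply: h; rewrite inE ?eqxx// js orbT.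
by move=> [Fi h] j; rewrite inE => /predU1P[->|/h].
Qed.

Context (hausX : hausdorff_space X).

Lemma closed_point x : closed [set x].
Proof. exact: (accessible_closed_set1 (hausdorff_accessible (hausX))). Qed.

Lemma open_minus W (s : seq X) : open W -> open [set x | W x /\ x \notin s].
Proof.
move=> oW; elim: s => [|y s IH].
  by rewrite (_ : [set _ | _] = W)//; apply/seteqP; split=> x; [case|].
rewrite (_ : [set _ | _] = [set x | W x /\ x \notin s] `&` ~` [set y]).
  by apply: openI => //; exact/closed_openC/closed_point.
apply/seteqP; split=> x /=; rewrite inE negb_or.
  by case=> Wx /andP[/eqP].
by case=> -[Wx ->] /eqP ->.
Qed.

(** Intersecting the separating neighbourhoods of x over the finitely many other
    points works since only pairs of points of s are involved. *)
Lemma separate (s : seq X) : exists N : X -> set X,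
  [/\ forall x, open (N x), forall x, N x x &
     forall x y z, x \in s -> y \in s -> x <> y -> N x z -> ~ N y z].
Proof.
have /choice[AB ABP] : forall p : X * X, exists AB : set X * set X,
    [/\ open AB.1, AB.1 p.1, open AB.2, AB.2 p.2 & p.1 <> p.2 -> AB.1 `&` AB.2 = set0].
  move=> [x y]; have [<-|xy] := eqVneq x y.
    by exists (setT, setT); split=> //=; exact: openT.
  have := hausX; rewrite open_hausdorff => /(_ x y xy).
  by move=> [[A B] /= [Ax By] [oA oB /eqP AB0]]; rewrite !inE in Ax By; exists (A, B).
pose F x y := if y == x then setT else (AB (x, y)).1 `&` (AB (y, x)).2.
exists (fun x => [set z | forall y, y \in s -> F x y z]); split=> [x|x y ys|x y z xs ys xy].
- apply: open_forall => y _; rewrite /F; case: eqP => _; first exact: openT.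
  by apply: openI; [have [] := ABP (x, y)|have [] := ABP (y, x)].
- rewrite /F; case: eqP => // _.
  by split; [have [] := ABP (x, y)|have [] := ABP (y, x)].
- move=> /(_ _ ys) /[swap] /(_ _ xs); rewrite /F.
  case: eqP => // _ [_ B1]; case: eqP => [|_ [A1 _]]; first by move/esym.
  have [_ _ _ _ /= /(_ xy) AB0] := ABP (x, y).
  by rewrite -[False]/(set0 z) -AB0.
Qed.

Context (perfX : forall x, ~ open [set x]).

Lemma open_minus_ne W (s : seq X) : open W -> W !=set0 ->
  [set x | W x /\ x \notin s] !=set0.
Proof.
move=> oW W0; elim: s => [|y s [z [Wz zs]]].
  by case: W0 => x Wx; exists x.
have [e|zy] := eqVneq z y; last by exists z; rewrite /= inE negb_or zy.
have oWs := open_minus s oW.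
apply: contrapT => noz; apply: (perfX (x := y)).
rewrite (_ : [set y] = [set x | W x /\ x \notin s])//.
apply/seteqP; split=> x /=; first by move=> ->; rewrite -e.
move=> [Wx xs]; apply: contrapT => xy; apply: noz; exists x.
by rewrite /= inE negb_or xs andbT; split=> //; apply/eqP.
Qed.

End FinitePoints.

Section Action.
Context {gT : groupType} {X : topologicalType} (to : group_action gT X).
Implicit Types (a b c g h k : gT) (x y z : X) (U V W : set X).

Lemma actK a x : to a^-1 (to a x) = x.
Proof. by rewrite -group_actM mulVg group_act1. Qed.

Lemma actKV a x : to a (to a^-1 x) = x.
Proof. by rewrite -group_actM mulgV group_act1. Qed.

Lemma act_inj a : injective (to a).
Proof. exact: can_inj (actK a). Qed.

(** The two other pieces, c U and c (c U), are described through the images of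
    points: as c has order 3, the point x is in c U iff c (c x) is in U.  An empty
    base gives the trivial element, so that restrictions of 3-cycles need no
    case distinction. *)
Definition three_cycle c U : Prop :=
  [/\ compact U, open U, forall x, U x -> ~ U (to c x),
      forall x, to c (to c (to c x)) = x &
      forall x, ~ U x -> ~ U (to c x) -> ~ U (to c (to c x)) -> to c x = x].

Definition cycle_support c U : set X :=
  [set x | [\/ U x, U (to c x) | U (to c (to c x))]].

Lemma three_cycle_fix c U x : three_cycle c U -> ~ cycle_support c U x -> to c x = x.
Proof.
by case=> _ _ _ _ fixc nx; apply: fixc => Ux; apply: nx; [constructor 1|constructor 2|constructor 3].
Qed.

Lemma three_cycle_ne c U x : three_cycle c U -> cycle_support c U x -> to c x <> x.
Proof.
case=> _ _ dU _ _ sx e; case: sx; rewrite ?e => Ux;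
  by apply: (dU x Ux); rewrite e.
Qed.

Lemma three_cycle_ne2 c U x : three_cycle c U -> cycle_support c U x -> to c (to c x) <> x.
Proof.
move=> cU sx e; apply: (three_cycle_ne cU sx); case: cU => _ _ _ c3 _.
by rewrite -{2}(c3 x) e.
Qed.

Lemma three_cycleV c U : three_cycle c U -> three_cycle c^-1 U.
Proof.
move=> [kU oU dU c3 fixc].
have cV x : to c^-1 x = to c (to c x) by rewrite -{1}(c3 x) actK.
split=> //; [move=> x Ux|move=> x|move=> x n1]; rewrite !cV ?c3.
- by move=> /dU; rewrite c3; apply.
- by [].
- by move=> n2 n3; have e := fixc x n1 n3 n2; rewrite !e.
Qed.

Lemma cycle_support_act c U x : (forall y, to c (to c (to c y)) = y) ->
  cycle_support c U x -> cycle_support c U (to c x).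
Proof.
move=> c3; rewrite /cycle_support /= !c3.
by case; [constructor 3|constructor 1|constructor 2].
Qed.

Definition germ_eq a b x := \forall y \near x, to a y = to b y.

Lemma germ_at a b x : germ_eq a b x -> to a x = to b x.
Proof. exact: nbhs_singleton. Qed.

Lemma germ_sym a b x : germ_eq a b x -> germ_eq b a x.
Proof. by apply: filterS. Qed.

Lemma germ_trans b a c x : germ_eq a b x -> germ_eq b c x -> germ_eq a c x.
Proof. by apply: filterS2 => y ->. Qed.

Lemma germ_mulr a b k x : germ_eq a b x -> germ_eq (k * a) (k * b) x.
Proof. by apply: filterS => y; rewrite !group_actM => ->. Qed.

Context (act_cont : forall a, continuous (to a)).

Lemma germ_mull a b k x : germ_eq a b (to k x) -> germ_eq (a * k) (b * k) x.
Proof.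
move=> ab; have : \forall y \near x, to a (to k y) = to b (to k y).
  exact: (@act_cont k x _ ab).
by apply: filterS => y; rewrite !group_actM.
Qed.

Lemma act_open a U : open U -> open [set x | U (to a x)].
Proof. by move=> oU; apply: open_comp => // x _; exact: act_cont. Qed.

Lemma act_closed a U : closed U -> closed [set x | U (to a x)].
Proof. by move=> oU; apply: closed_comp => // x _; exact: act_cont. Qed.

Lemma act_compact a U : compact U -> compact [set x | U (to a x)].
Proof.
move=> kU.
have -> : [set x | U (to a x)] = to a^-1 @` U.
  apply/seteqP; split=> x /=; first by exists (to a x); rewrite ?actK.
  by move=> [y Uy <-]; rewrite actKV.
by apply: continuous_compact => //; apply: continuous_subspaceT; exact: act_cont.
Qed.

Lemma cycle_supportE c U : cycle_support c U =
  U `|` ([set x | U (to c x)] `|` [set x | [set y | U (to c y)] (to c x)]).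
Proof.
apply/seteqP; split=> x; first by case=> ?; [left|right; left|right; right].
by case=> [|[]] ?; [constructor 1|constructor 2|constructor 3].
Qed.

Lemma cycle_support_open c U : open U -> open (cycle_support c U).
Proof.
move=> oU; rewrite cycle_supportE; apply: openU => //; apply: openU; first exact: act_open.
by apply: act_open; exact: act_open.
Qed.

Lemma cycle_support_closed c U : closed U -> closed (cycle_support c U).
Proof.
move=> cU; rewrite cycle_supportE; apply: closedU => //; apply: closedU; first exact: act_closed.
by apply: act_closed; exact: act_closed.
Qed.

Lemma cycle_support_compact c U : compact U -> compact (cycle_support c U).
Proof.
move=> kU; rewrite cycle_supportE; apply: compactU => //; apply: compactU.
  exact: act_compact.
by apply: act_compact; exact: act_compact.
Qed.

Lemma three_cycleJ k c U : three_cycle c U -> three_cycle (k * c * k^-1) [set y | U (to k^-1 y)].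
Proof.
move=> [kU oU dU c3 fixc]; split.
- exact: act_compact.
- exact: act_open.
- by move=> x /=; rewrite !group_actM actK; exact: dU.
- by move=> x; rewrite !group_actM !actK c3 actKV.
- by move=> x /=; rewrite !group_actM !actK => ? ? ?; rewrite fixc// actKV.
Qed.

End Action.

(** * Actions rich in 3-cycles *)

(** Restriction of a 3-cycle to a smaller base.  The support is computed with c, so
    that restrictions of c to different bases are compared easily. *)
Definition is_cut (gT : groupType) (X : topologicalType)
    (to : group_action gT X) (c : gT) (V : set X) (c' : gT) : Prop :=
  (forall x, cycle_support to c V x -> to c' x = to c x) /\
  (forall x, ~ cycle_support to c V x -> to c' x = x).

(** What the argument uses of alternating groups.  The finite sets s fixed in
    [ra_move] and [ra_germ] leave room for generic choices, in particular for the
    third point of a 3-cycle. *)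
Record rich_action (gT : groupType) (X : topologicalType)
    (to : group_action gT X) : Prop := RichAction {
  ra_hausdorff : hausdorff_space X;
  ra_base : forall (O : set X) x, open O -> O x ->
    exists B, [/\ compact B, open B, B x & B `<=` O];
  ra_perfect : forall x : X, ~ open [set x];
  ra_cont : forall a, continuous (to a);
  ra_faithful : forall a b, (forall x, to a x = to b x) -> a = b;
  ra_ind : forall P : gT -> Prop, P 1 ->
    (forall c U g, three_cycle to c U -> P g -> P (c * g)) -> forall g, P g;
  ra_cut : forall c U V, three_cycle to c U -> compact V -> open V -> V `<=` U ->
    exists c', three_cycle to c' V /\ is_cut to c V c';
  ra_move : forall x (s : seq X) (W : set X), open W -> W !=set0 -> x \notin s ->
    ~ W x ->
    exists c U, [/\ three_cycle to c U, W (to c x) & forall y, y \in s -> to c y = y];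
  ra_germ : forall g x (s : seq X), to g x <> x -> x \notin s -> to g x \notin s ->
    exists c U, [/\ three_cycle to c U, germ_eq to c g x & forall y, y \in s -> to c y = y]
}.

Section Cosets.
Context {gT : groupType} {X : topologicalType} {to : group_action gT X}.
Context (HA : rich_action to).
Implicit Types (a b c g h k : gT) (x y z : X) (U V W : set X).

Let act_cont := ra_cont HA.
Notation germ_eq := (germ_eq to).

Definition is_cycle c := exists U, three_cycle to c U.

Lemma closed_compact U : compact U -> closed U.
Proof. exact: compact_closed (ra_hausdorff HA). Qed.

(** The three pieces of a 3-cycle play the same role, so the base can be rotated
    to contain any point that is moved. *)
Lemma cyc_at c U x : three_cycle to c U -> to c x <> x ->
  exists U', three_cycle to c U' /\ U' x.
Proof.
move=> cU mx; have sx : cycle_support to c U x.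
  by apply: contrapT => /(three_cycle_fix cU).
case: (sx) => Ux; first by exists U.
- exists [set y | U (to c y)]; split=> //.
  by have := three_cycleJ act_cont c^-1 cU; rewrite invgK mulVg mul1g.
exists [set y | U (to c^-1 y)]; split.
  by have := three_cycleJ act_cont c cU; rewrite mulgK.
by case: cU => _ _ _ c3 _; rewrite /= -{1}(c3 x) actK.
Qed.

(** The support of a 3-cycle is clopen. *)
Lemma is_cycle_fix_germ c x : is_cycle c -> to c x = x -> germ_eq c 1 x.
Proof.
move=> [U cU] cx.
have : ~ cycle_support to c U x by move=> /(three_cycle_ne cU).
have oS : open (~` cycle_support to c U).
  apply: closed_openC; apply: (cycle_support_closed act_cont); apply: closed_compact.
  by case: cU.
move=> nx; have : nbhs x (~` cycle_support to c U) by exact: open_nbhs_nbhs.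
by apply: filterS => y ny; rewrite (three_cycle_fix cU ny) group_act1.
Qed.

Lemma is_cycleV c : is_cycle c -> is_cycle c^-1.
Proof. by case=> U cU; exists U; exact: three_cycleV. Qed.

Lemma is_cycleJ k c : is_cycle c -> is_cycle (k * c * k^-1).
Proof. by case=> U cU; eexists; exact: three_cycleJ cU. Qed.

Lemma is_cycle_ne2 c x : is_cycle c -> to c x <> x -> to c (to c x) <> x.
Proof.
move=> [U cU] cx; apply: (three_cycle_ne2 cU); apply: contrapT => /(three_cycle_fix cU); exact: cx.
Qed.

Definition cycles_fixing x := [set c | is_cycle c /\ to c x = x].
(** It will turn out to consist of all the elements that are trivial near x; until
    then, two elements count as equal at x when they are in the same left coset
    of this group, a relation that composes like germs do. *)
Definition cycles_off x : set gT := generated_subgroup (cycles_fixing x).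

Lemma cycles_off_closed x : group_closed (mem (cycles_off x)).
Proof. exact: generated_subgroup_closed. Qed.

Lemma cycles_off1 x : cycles_off x 1.
Proof. by have [] := cycles_off_closed x; rewrite inE. Qed.

Lemma cycles_offM x a b : cycles_off x a -> cycles_off x b -> cycles_off x (a * b).
Proof. by have := group_closedM (cycles_off_closed x) (x := a) (y := b); rewrite !inE. Qed.

Lemma cycles_offV x a : cycles_off x a -> cycles_off x a^-1.
Proof. by have := group_closedV (cycles_off_closed x) (x := a); rewrite !inE. Qed.

Lemma cycles_off_cycle x c : is_cycle c -> to c x = x -> cycles_off x c.
Proof. by move=> ic cx; apply: sub_gen_smallest; split. Qed.

Lemma cycles_off_ind x (P : gT -> Prop) : P 1 -> (forall a b, P a -> P b -> P (a * b^-1)) ->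
  (forall c, is_cycle c -> to c x = x -> P c) -> forall a, cycles_off x a -> P a.
Proof.
move=> P1 PD Po a Ja; apply: (Ja [set a | P a]); split; last first.
  by move=> c [ic cx]; exact: Po.
by split=> [|u v]; rewrite !inE; [exact: P1|exact: PD].
Qed.

Lemma cycles_off_conj k x a : cycles_off x a -> cycles_off (to k x) (k * a * k^-1).
Proof.
move: a; apply: cycles_off_ind => [|a b Ja Jb|c ic cx].
- by rewrite mulg1 mulgV; exact: cycles_off1.
- rewrite (_ : _ * _ = (k * a * k^-1) * (k * b * k^-1)^-1).
    by apply: cycles_offM => //; exact: cycles_offV.
  by rewrite !invgM invgK !mulgA mulgVK.
- by apply: cycles_off_cycle; [exact: is_cycleJ|rewrite !group_actM actK cx].
Qed.

Lemma cycles_off_germ x a : cycles_off x a -> germ_eq a 1 x.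
Proof.
move: a; apply: cycles_off_ind => [|a b Ja Jb|c]; last exact: is_cycle_fix_germ.
  by apply: nearW.
have Jb' : \forall y \near x, to b^-1 y = y.
  by move: Jb; apply: filterS => y; rewrite group_act1 => {1}<-; rewrite actK.
by move: Ja Jb'; apply: filterS2 => y ay by_; rewrite group_actM by_.
Qed.

Definition same_coset x g h := cycles_off x (h^-1 * g).

Lemma same_coset_refl x g : same_coset x g g.
Proof. by rewrite /same_coset mulVg; exact: cycles_off1. Qed.

Lemma same_coset_sym x g h : same_coset x g h -> same_coset x h g.
Proof. by move=> /cycles_offV; rewrite invgM invgK. Qed.

Lemma same_coset_trans x g h k : same_coset x g h -> same_coset x h k -> same_coset x g k.
Proof.
by move=> gh hk; rewrite /same_coset -(mulgK h k^-1) -mulgA; exact: cycles_offM.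
Qed.

Lemma same_coset_germ x g h : same_coset x g h -> germ_eq g h x.
Proof.
move=> /cycles_off_germ; apply: filterS => y; rewrite group_actM group_act1 => e.
by rewrite -[in RHS]e actKV.
Qed.

(** Conjugation by g' takes the group at x to the group at g' x = g x. *)
Lemma same_coset_mul x g g' h h' : same_coset x g g' -> same_coset (to g x) h h' ->
  same_coset x (h * g) (h' * g').
Proof.
move=> gg hh; have e := germ_at (same_coset_germ gg).
rewrite /same_coset (_ : _ * _ = (g'^-1 * (h'^-1 * h) * (g'^-1)^-1) * (g'^-1 * g)).
  by apply: cycles_offM => //; rewrite -[x](@actK _ _ to g') -e; exact: cycles_off_conj.
by rewrite invgK invgM !mulgA mulgK.
Qed.

Lemma same_coset_mull x g g' h : same_coset x g g' -> same_coset x (h * g) (h * g').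
Proof. by move=> gg; apply: same_coset_mul => //; exact: same_coset_refl. Qed.

Lemma same_coset_mulr x g h h' : same_coset (to g x) h h' -> same_coset x (h * g) (h' * g).
Proof. by apply: same_coset_mul; exact: same_coset_refl. Qed.

Lemma same_coset_fix x c : is_cycle c -> to c x = x -> same_coset x c 1.
Proof. by move=> ic cx; rewrite /same_coset invg1 mul1g; exact: cycles_off_cycle. Qed.

(** The nine cases reduce to the disjointness of U, c U and c (c U). *)
Lemma cycle_support_disj c U V W x : three_cycle to c U -> V `<=` U -> W `<=` U ->
  V `&` W = set0 -> cycle_support to c V x -> ~ cycle_support to c W x.
Proof.
move=> [_ _ dU c3 _] VU WU VW.
have dVW y : V y -> W y -> False by move=> Vy Wy; rewrite -[False]/(set0 y) -VW.
have d y : U y -> U (to c y) -> False by move=> Uy /(dU _ Uy).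
have d2 y : U y -> U (to c (to c y)) -> False.
  by move=> Uy Uccy; apply: (d _ Uccy); rewrite c3.
by case=> Vx [] Wx; (try exact: dVW Vx Wx); move/VU: Vx => Vx; move/WU: Wx => Wx;
  ((by apply: d Vx _) || (by apply: d2 Vx _) || (by apply: d Wx _) || (by apply: d2 Wx _)).
Qed.

Lemma is_cut_self c U : three_cycle to c U -> is_cut to c U c.
Proof. by move=> cU; split=> // x; exact: three_cycle_fix. Qed.

Lemma cut_mul c U V W c' c1 c2 : three_cycle to c U -> V `<=` U -> W `<=` U ->
  V `&` W = set0 -> is_cut to c (V `|` W) c' -> is_cut to c V c1 ->
  is_cut to c W c2 -> c' = c1 * c2.
Proof.
move=> cU VU WU VW0 [e1 e2] [f1 f2] [g1 g2]; apply: (ra_faithful HA) => x.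
rewrite group_actM.
have [Wx|nWx] := pselect (cycle_support to c W x).
  rewrite g1// f2//; last first.
    apply: (@cycle_support_disj c U W V) => //; first by rewrite setIC.
    case: cU => _ _ _ c3 _; case: Wx; rewrite /cycle_support /= !c3 => ?.
    - by constructor 3.
    - by constructor 1.
    - by constructor 2.
  by apply: e1; case: Wx => ?; [constructor 1|constructor 2|constructor 3]; right.
rewrite (g2 x)//.
have [Vx|nVx] := pselect (cycle_support to c V x).
  by rewrite f1// e1//; case: Vx => ?; [constructor 1|constructor 2|constructor 3]; left.
rewrite f2// e2// => -[] [] ?; by [
  apply: nVx; constructor 1 | apply: nWx; constructor 1 |
  apply: nVx; constructor 2 | apply: nWx; constructor 2 |
  apply: nVx; constructor 3 | apply: nWx; constructor 3].
Qed.

Lemma three_cycle_eq c c' V : three_cycle to c V -> three_cycle to c' V ->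
  (forall x, V x -> to c x = to c' x) ->
  (forall x, V x -> to c (to c x) = to c' (to c' x)) -> c = c'.
Proof.
move=> cV cV' e1 e2; apply: (ra_faithful HA) => x.
case: (cV) (cV') => _ _ _ c3 _ [_ _ _ c3' _].
have key a b y : three_cycle to a V -> three_cycle to b V ->
    (forall x, V x -> to a x = to b x) ->
    (forall x, V x -> to a (to a x) = to b (to b x)) ->
    cycle_support to a V y -> to a y = to b y.
  move=> [_ _ _ a3 _] [_ _ _ b3 _] f1 f2; case=> Vy; first exact: f1.
    have -> : y = to a (to a (to a y)) by rewrite a3.
    by rewrite [in RHS](f2 _ Vy) a3 b3.
  have -> : y = to a (to a (to a y)) by rewrite a3.
  by rewrite [in RHS](f1 _ Vy) (f2 _ Vy).
have [sx|nsx] := pselect (cycle_support to c V x); first exact: key.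
have [sx'|nsx'] := pselect (cycle_support to c' V x).
  by symmetry; apply: key => // y Vy; [rewrite e1|rewrite e2].
by rewrite (three_cycle_fix cV nsx) (three_cycle_fix cV' nsx').
Qed.

Lemma small_base U (N : set X) x : open U -> U x -> nbhs x N ->
  exists V, [/\ compact V, open V, V x, V `<=` U & V `<=` N].
Proof.
move=> oU Ux; rewrite nbhsE => -[O [oO Ox] ON].
have [V [kV oV Vx VUO]] := ra_base HA (openI oU oO) (conj Ux Ox).
by exists V; split=> // y /VUO[] // _ /ON.
Qed.

Lemma setD_compact_open U V : compact U -> open U -> compact V -> open V ->
  compact (U `\` V) /\ open (U `\` V).
Proof.
move=> kU oU kV oV; split.
  apply: (@subclosed_compact _ _ U) => //; apply: closedI; first exact: closed_compact.
  exact: open_closedC.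
by apply: openI => //; apply: closed_openC; exact: closed_compact.
Qed.

(** A 3-cycle is the product of its restrictions to V and to the complement of V
    in U, and the latter fixes x. *)
Lemma same_coset_cut c U V c' x : three_cycle to c U -> compact V -> open V -> V `<=` U ->
  is_cut to c V c' -> V x -> same_coset x c c'.
Proof.
move=> cU kV oV VU c'V Vx; case: (cU) => kU oU _ c3 _.
have [kW oW] := setD_compact_open kU oU kV oV.
have WU : U `\` V `<=` U by move=> y [].
have VW0 : V `&` (U `\` V) = set0 by rewrite setDE setIC -setIA setICl setI0.
have [c'' [cW c''W]] := ra_cut HA cU kW oW WU.
have -> : c = c' * c''.
  apply: (cut_mul cU VU WU VW0) => //; rewrite setDUK//; exact: is_cut_self.
rewrite /same_coset mulKg; apply: cycles_off_cycle; first by exists (U `\` V).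
by apply: c''W.2; apply: (cycle_support_disj cU VU WU) => //; constructor 1.
Qed.

(** Restricted to a small base around x, the 3-cycles c and c' differ only in
    their third pieces, around c (c x) and c' (c' x).  As these two points differ,
    some 3-cycle k fixing x and c x matches the third pieces, so that conjugation
    by k turns the restriction of c into that of c'.  Both k and its conjugate by
    c are trivial at x, so conjugation by k does not change the coset. *)
Lemma same_coset_cycle_ne c c' x : is_cycle c -> is_cycle c' -> to c x <> x -> germ_eq c c' x ->
  to c (to c x) <> to c' (to c' x) -> same_coset x c c'.
Proof.
move=> [U0 cU0] [U0' cU0'] mx gc ww.
have e := germ_at gc.
have [U [cU Ux]] := cyc_at cU0 mx.
have [U' [cU' U'x]] : exists U', three_cycle to c' U' /\ U' x.
  by apply: cyc_at cU0' _; rewrite -e.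
have ic : is_cycle c by exists U.
have ic' : is_cycle c' by exists U'.
set y := to c x in mx e ww *; set w := to c y in ww *.
have wx : w <> x by exact: is_cycle_ne2.
have wy : w <> y by move/act_inj.
have w'x : to c' y <> x by rewrite e; apply: is_cycle_ne2 => //; rewrite -e.
have w'y : to c' y <> y by rewrite e => /act_inj; rewrite -e.
rewrite -e in ww.
(* The germ at w = c (c x) that matches the third pieces. *)
pose g := c' * c' * c^-1 * c^-1.
have gw : to g w = to c' y by rewrite !group_actM !actK -e.
have [|||k [Uk [ck gk kfix]]] := @ra_germ _ _ _ HA g w [:: x; y].
- by rewrite gw; exact: nesym.
- by rewrite !inE negb_or; apply/andP; split; apply/eqP.
- by rewrite gw !inE negb_or; apply/andP; split; apply/eqP.
have ik : is_cycle k by exists Uk.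
have kx : to k x = x by apply: kfix; rewrite !inE eqxx.
have ky : to k y = y by apply: kfix; rewrite !inE eqxx orbT.
have n1 := is_cycle_fix_germ ik kx.
have n2 : \forall z \near x, to k (to c z) = to c z.
  have : germ_eq (k * c) (1 * c) x by apply: germ_mull => //; exact: is_cycle_fix_germ.
  by apply: filterS => z; rewrite mul1g group_actM.
have n3 : \forall z \near x, to k (to c (to c z)) = to c' (to c' z).
  have : germ_eq (k * (c * c)) (g * (c * c)) x.
    by apply: germ_mull => //; rewrite group_actM.
  by apply: filterS => z; rewrite /g !mulgA !mulgVK !group_actM.
have nU' : nbhs x U' by apply: open_nbhs_nbhs; split=> //; case: cU'.
have oU : open U by case: cU.
have [V [kV oV Vx VU VN]] :=
  small_base oU Ux (filterI nU' (filterI gc (filterI n1 (filterI n2 n3)))).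
have VU' : V `<=` U' by move=> z /VN[].
have [d [dV dc]] := ra_cut HA cU kV oV VU.
have [d' [dV' dc']] := ra_cut HA cU' kV oV VU'.
case: (dc) (dc') => d1 d2 [d1' d2'].
case: (cU) (cU') => _ _ _ c3 _ [_ _ _ c3' _].
have dd z : V z -> to d z = to c z by move=> Vz; apply: d1; constructor 1.
have dd2 z : V z -> to d (to d z) = to c (to c z).
  by move=> Vz; rewrite (dd z Vz) d1//; rewrite /cycle_support /= c3; constructor 3.
have dd' z : V z -> to d' z = to c' z by move=> Vz; apply: d1'; constructor 1.
have dd2' z : V z -> to d' (to d' z) = to c' (to c' z).
  by move=> Vz; rewrite (dd' z Vz) d1'//; rewrite /cycle_support /= c3'; constructor 3.
have kV1 z : V z -> to k z = z by move=> /VN[_ [_ []]]; rewrite group_act1.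
have kVV z : V z -> to k^-1 z = z by move=> Vz; rewrite -{1}(kV1 z Vz) actK.
have E : k * d * k^-1 = d'.
  have := three_cycleJ act_cont k dV.
  rewrite (_ : [set z | V (to k^-1 z)] = V); last first.
    apply/seteqP; split=> z /= Vz; last by rewrite kVV.
    by have := kV1 _ Vz; rewrite actKV => ->.
  move=> cV; apply: (three_cycle_eq cV dV') => z Vz; rewrite !group_actM ?actK kVV//.
    by have [_ [e1 [_ [e2 _]]]] := VN _ Vz; rewrite dd// e2 e1 dd'.
  by have [_ [_ [_ [_ e3]]]] := VN _ Vz; rewrite dd2// e3 dd2'.
apply: same_coset_trans (same_coset_cut cU kV oV VU dc Vx) _.
apply: same_coset_sym; apply: same_coset_trans (same_coset_cut cU' kV oV VU' dc' Vx) _.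
have dx : to d x = y by rewrite dd.
rewrite -E.
apply: (@same_coset_trans _ _ (k * d)).
    rewrite /same_coset mulKg; apply: cycles_off_cycle; first exact: is_cycleV.
    by rewrite -{1}kx actK.
  rewrite -[X in same_coset _ _ X]mul1g; apply: same_coset_mulr; rewrite dx; exact: same_coset_fix.
Qed.

End Cosets.

(** * Elements with trivial germ at a point *)

Section TrivialGerm.
Context {gT : groupType} {X : topologicalType} {to : group_action gT X}.
Context (HA : rich_action to).
Implicit Types (a b c g h k : gT) (x y z : X) (U V W : set X).

Let act_cont := ra_cont HA.
Notation germ_eq := (germ_eq to).
Notation is_cycle := (@is_cycle _ _ to).
Notation cycles_off := (@cycles_off _ _ to).
Notation same_coset := (@same_coset _ _ to).

Lemma move_off x (s t : seq X) W : open W -> W !=set0 -> x \notin s ->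
  exists c, [/\ is_cycle c, W (to c x), forall y, y \in s -> to c y = y &
     to c x \notin x :: t].
Proof.
move=> oW W0 xs.
have [|||c [U [cU Wcx cs]]] :=
    @ra_move _ _ _ HA x s _ (open_minus (ra_hausdorff HA) (x :: t) oW).
- exact: (open_minus_ne (ra_hausdorff HA) (@ra_perfect _ _ _ HA)).
- by [].
- by move=> [_]; rewrite inE eqxx.
by case: Wcx => Wcx cxt; exists c; split=> //; exists U.
Qed.

Lemma move_away x (s t : seq X) : x \notin s ->
  exists c, [/\ is_cycle c, forall y, y \in s -> to c y = y & to c x \notin x :: t].
Proof.
move=> xs; have [|c [? ? ? ?]] := @move_off x s t setT openT _ xs.
  by exists x.
by exists c.
Qed.

Lemma germ_cycle g x (s : seq X) : to g x <> x -> x \notin s -> to g x \notin s ->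
  exists c, [/\ is_cycle c, germ_eq c g x & forall y, y \in s -> to c y = y].
Proof.
by move=> h1 h2 h3; have [c [U [cU ? ?]]] := ra_germ HA h1 h2 h3;
  exists c; split=> //; exists U.
Qed.

(** If the third points c (c x) and c' (c' x) coincide, compare both 3-cycles with
    a third one that has the same germ at x and another third point. *)
Lemma same_coset_cycle c c' x : is_cycle c -> is_cycle c' -> to c x <> x -> germ_eq c c' x ->
  same_coset x c c'.
Proof.
move=> ic ic' mx gc.
have [ww|/eqP ww] := eqVneq (to c (to c x)) (to c' (to c' x)); last exact: same_coset_cycle_ne.
have e := germ_at gc.
have cx : to c (to c x) <> x by exact: is_cycle_ne2.
have ccx : to c (to c x) <> to c x by move/act_inj.
have [|k [ik kfix kw]] := @move_away (to c (to c x)) [:: x; to c x] [::].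
  by rewrite !inE negb_or; apply/andP; split; apply/eqP.
have kx : to k x = x by apply: kfix; rewrite !inE eqxx.
have ky : to k (to c x) = to c x by apply: kfix; rewrite !inE eqxx orbT.
have kV y : to k y = y -> to k^-1 y = y by move=> {1}<-; rewrite actK.
pose d := k * c * k^-1.
have id : is_cycle d by exact: (is_cycleJ HA).
have gk : germ_eq (k^-1) 1 x by apply: (is_cycle_fix_germ HA); [exact: is_cycleV|exact: kV].
have dx : to d x = to c x by rewrite !group_actM kV.
have gd : germ_eq d c x.
  rewrite -[c in germ_eq _ c]mulg1; apply: (@germ_trans _ _ _ (c * k^-1)); last exact: germ_mulr.
  rewrite /d -mulgA -[X in germ_eq _ X]mul1g; apply: (germ_mull act_cont).
  by apply: (is_cycle_fix_germ HA) => //; rewrite group_actM kV.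
have dd : to d (to d x) = to k (to c (to c x)).
  by rewrite dx !group_actM (kV _ ky).
apply: (same_coset_trans (h := d)).
  apply: (same_coset_cycle_ne HA) => //; first exact: germ_sym.
  by rewrite dd => E; rewrite -E !inE eqxx in kw.
apply: (same_coset_cycle_ne HA) => //; first by rewrite dx.
  exact: germ_trans gd gc.
by rewrite dd -ww; apply/eqP; move: kw; rewrite inE.
Qed.

(** By the previous lemma c may be replaced by a 3-cycle d with the same germ at
    b x that fixes x; then d * b = (d * b * d^-1) * d, where the last factor fixes
    x and the conjugate of b is again a 3-cycle. *)
Lemma same_coset_comp c b a x : is_cycle c -> is_cycle b -> is_cycle a -> to b x <> x ->
  to c (to b x) <> x -> germ_eq (c * b) a x -> same_coset x (c * b) a.
Proof.
move=> ic ib ia bx cbx gab.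
have [cy|/eqP cy] := eqVneq (to c (to b x)) (to b x).
  have e : same_coset x (c * b) b.
    by rewrite -[X in same_coset _ _ X]mul1g; apply: (same_coset_mulr HA); exact: same_coset_fix.
  apply: (same_coset_trans e); apply: same_coset_cycle => //.
  by apply: germ_trans gab; apply/germ_sym/(same_coset_germ HA).
have [||d [id gd dfix]] := @germ_cycle c (to b x) [:: x] cy.
- by rewrite inE; apply/eqP.
- by rewrite inE; apply/eqP.
have dx : to d x = x by apply: dfix; rewrite inE.
have e1 : same_coset x (c * b) (d * b).
  apply: (same_coset_mulr HA); apply: same_coset_cycle => //; exact: germ_sym.
have e2 : same_coset x (d * b) (d * b * d^-1).
  rewrite -[X in same_coset _ X](mulgVK d (d * b)) -[X in same_coset _ _ X]mulg1.
  by apply: (same_coset_mull HA); exact: same_coset_fix.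
apply: (same_coset_trans e1); apply: (same_coset_trans e2); apply: same_coset_cycle => //.
- exact: (is_cycleJ HA).
- by rewrite -(germ_at (same_coset_germ HA (same_coset_trans e1 e2))) group_actM.
- by apply: germ_trans gab; apply: germ_sym; exact: (same_coset_germ HA (same_coset_trans e1 e2)).
Qed.

(** Induction on the length of g as a word in 3-cycles.  Composing with h gives
    the path z, x, g x a starting point z that the germ of g * h moves, so that
    at each step the product of the letters read so far is replaced by a single
    3-cycle. *)
Lemma same_coset_word g : forall x z h a, is_cycle h -> is_cycle a -> to h z = x -> z <> x ->
  to g x <> z -> germ_eq (g * h) a z -> same_coset z (g * h) a.
Proof.
move: g; apply: (ra_ind HA) => [x z h a ih ia hz zx _|c U g cU IH x z h a ih ia hz zx uz ga].
  by rewrite mul1g => ?; apply: same_coset_cycle => //; rewrite hz; exact: nesym.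
have ic : is_cycle c by exists U.
rewrite group_actM in uz.
(* If g x = z, the path from z to g x returns to its origin; it is then split at a
   new point z'. *)
have [yz|/eqP yz] := eqVneq (to g x) z; last first.
  have [|||b [ib gb _]] := @germ_cycle (g * h) z [::]; rewrite ?group_actM ?hz//.
  have e1 : same_coset z (g * h) b by apply: IH hz _ _ _ => //; exact: germ_sym.
  have bz : to b z = to g x by rewrite (germ_at gb) group_actM hz.
  have e2 : same_coset z (c * g * h) (c * b) by rewrite -mulgA; exact: (same_coset_mull HA).
  apply: (same_coset_trans e2); apply: same_coset_comp => //; rewrite ?bz//.
  by apply: germ_trans ga; apply/germ_sym/(same_coset_germ HA).
have [|h1 [ih1 _ h1z]] := @move_away z [::] [:: x; to c (to g x)] => //.
move: h1z; set z' := to h1 z; rewrite !inE !negb_or => /and3P[/eqP z'z /eqP z'x /eqP z'u].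
have h1V : to h1^-1 z' = z by rewrite /z' actK.
have [|||h2 [ih2 gh2 _]] := @germ_cycle (h * h1^-1) z' [::]; rewrite ?group_actM ?h1V ?hz//.
  exact: nesym.
have h2z' : to h2 z' = x by rewrite (germ_at gh2) group_actM h1V.
have e1 : same_coset z (h2 * h1) h.
  apply: same_coset_comp => //; first by rewrite -/z' h2z'; exact: nesym.
  by rewrite -[h in germ_eq _ h](mulgVK h1); exact: (germ_mull act_cont).
have [|||b1 [ib1 gb1 _]] := @germ_cycle (g * h2) z' [::]; rewrite ?group_actM ?h2z' ?yz//.
  exact: nesym.
have e2 : same_coset z' (g * h2) b1.
  by apply: IH h2z' _ _ _ => //; [rewrite yz; exact: nesym|exact: germ_sym].
have b1z' : to b1 z' = z by rewrite (germ_at gb1) group_actM h2z'.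
have [|||b2 [ib2 gb2 _]] := @germ_cycle (c * b1) z' [::]; rewrite ?group_actM ?b1z' //.
  by rewrite -yz; exact: nesym.
have b2z' : to b2 z' = to c z by rewrite (germ_at gb2) group_actM b1z'.
have e3 : same_coset z' (c * b1) b2.
  apply: same_coset_comp => //; [by rewrite b1z'; exact: nesym| |exact: germ_sym].
  by rewrite b1z' -yz; exact: nesym.
have e4 : same_coset z (c * g * h) (b2 * h1).
  apply: (same_coset_trans (h := c * g * h2 * h1)).
    by rewrite -[X in same_coset _ _ X]mulgA; apply: (same_coset_mull HA); exact: same_coset_sym.
  apply: (same_coset_mulr HA); apply: (same_coset_trans _ e3).
  by rewrite -mulgA; exact: (same_coset_mull HA).
apply: (same_coset_trans e4); apply: same_coset_comp => //.
  by rewrite -/z' b2z' -{1}yz.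
by apply: germ_trans ga; apply/germ_sym/(same_coset_germ HA).
Qed.

(** If a is trivial near x and h is a 3-cycle from z to x, with z different from x,
    then a * h and h have the same germ at z; the previous lemma applies to
    them. *)
Lemma cycles_off_of_germ x a : germ_eq a 1 x -> cycles_off x a.
Proof.
move=> gx; have ax : to a x = x by rewrite (germ_at gx) group_act1.
have [//|k [ik _ kx]] := @move_away x [::] [::].
rewrite inE in kx; move/eqP: kx => kx.
pose h := k^-1; pose z := to k x.
have hz : to h z = x by exact: actK.
have ih : is_cycle h by exact: is_cycleV.
have e : same_coset z (a * h) h.
  apply: (same_coset_word (x := x)) => //; first by rewrite ax; exact: nesym.
  by rewrite -[X in germ_eq _ X]mul1g; apply: (germ_mull act_cont); rewrite hz.
by have := cycles_off_conj HA (k := h) e; rewrite hz mulVKg mulgK.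
Qed.

End TrivialGerm.

(** * Subgroups containing 3-cycles, and moving points apart *)

Definition is_subgroup (gT : groupType) (K : gT -> Prop) : Prop :=
  K 1 /\ forall a b, K a -> K b -> K (a * b^-1).

Section Subgroup.
Context {gT : groupType} {K : gT -> Prop} (HK : is_subgroup K).

Lemma subgroup1 : K 1. Proof. by case: HK. Qed.

Lemma subgroupV a : K a -> K a^-1.
Proof. by case: HK => K1 KD Ka; rewrite -[a^-1]mul1g; exact: KD. Qed.

Lemma subgroupM a b : K a -> K b -> K (a * b).
Proof. by move=> Ka /subgroupV Kb; rewrite -[b]invgK; case: HK => _; exact. Qed.

End Subgroup.

Section MovingPoints.
Context {gT : groupType} {X : topologicalType} {to : group_action gT X}.
Context (HA : rich_action to).
Implicit Types (a b c g h k : gT) (x y z : X) (U V W : set X).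

Let act_cont := ra_cont HA.
Notation is_cycle := (@is_cycle _ _ to).

(** Compact open sets all of whose compact open subsets satisfy P are stable under
    union.  Were U not one of them, their complements in U would generate a filter
    with a cluster point in U, contradicting the local hypothesis there. *)
Lemma compact_open_ind (P : set X -> Prop) U : compact U -> open U -> P set0 ->
  (forall V W, compact V -> open V -> compact W -> open W -> V `<=` U -> W `<=` U ->
    V `&` W = set0 -> P V -> P W -> P (V `|` W)) ->
  (forall x, U x -> exists2 N, nbhs x N &
    forall V, compact V -> open V -> V `<=` U -> V `<=` N -> P V) -> P U.
Proof.
move=> kU oU P0 PU Ploc; apply: contrapT => nPU.
(* Requiring P for all compact open subsets makes D stable under union. *)
pose D V := [/\ compact V, open V, V `<=` U &
  forall W, compact W -> open W -> W `<=` V -> P W].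
have FF : Filter (filter_from D (fun V => U `\` V)).
  apply: filter_from_filter.
    exists set0; split; [exact: compact0|exact: open0|by []|].
    by move=> W _ _; rewrite subset0 => ->.
  move=> V1 V2 [k1 o1 s1 P1] [k2 o2 s2 P2]; exists (V1 `|` V2); last first.
    by move=> y [Uy nV]; split; split=> // Vy; apply: nV; [left|right].
  split; [exact: compactU|exact: openU|by rewrite subUset|].
  move=> W kW oW WV.
  have [kD oD] := setD_compact_open HA kW oW k1 o1.
  have kI : compact (W `&` V1).
    by apply: (@subclosed_compact _ _ W) => //; apply: closedI; exact: (closed_compact HA).
  have WU : W `<=` U by move=> y /WV[/s1|/s2].
  have -> : W = (W `&` V1) `|` (W `\` V1) by rewrite setUIDK.
  apply: PU => //.
  - exact: openI.
  - by move=> y [/WU].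
  - by move=> y [/WU].
  - by rewrite setDE setIACA setICr setI0.
  - by apply: P1 => //; exact: openI.
  - by apply: P2 => // y [/WV[]].
have PF : ProperFilter (filter_from D (fun V => U `\` V)).
  apply: filter_from_proper => // V [kV oV VU PV].
  apply: contrapT => no; apply: nPU; apply: PV => // x Ux.
  by apply: contrapT => nVx; apply: no; exists x.
have [|x [Ux clx]] := kU _ PF.
  exists set0; last by move=> x [].
  split; [exact: compact0|exact: open0|by []|].
  by move=> W _ _; rewrite subset0 => ->.
have [N nN PN] := Ploc _ Ux.
have [B [kB oB Bx BU BN]] := small_base HA oU Ux nN.
have [||y [[_ nBy] By]] := clx (U `\` B) B; last exact: nBy.
  exists B => //; split=> // W kW oW WB; apply: PN => //.
    exact: subset_trans WB BU.
  exact: subset_trans WB BN.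
exact: open_nbhs_nbhs.
Qed.

(** 3-cycles are the products of their restrictions to the parts of a partition of
    the base. *)
Lemma cyc_local (K : gT -> Prop) c U : is_subgroup K -> three_cycle to c U ->
  (forall x, U x -> exists2 N, nbhs x N &
    forall V c', compact V -> open V -> V `<=` U -> V `<=` N -> three_cycle to c' V ->
      is_cut to c V c' -> K c') -> K c.
Proof.
move=> HK cU Kloc; case: (cU) => kU oU _ _ _.
suff : forall c', three_cycle to c' U -> is_cut to c U c' -> K c'.
  by apply=> //; exact: is_cut_self.
apply: (compact_open_ind (P := fun V => forall c', three_cycle to c' V ->
   is_cut to c V c' -> K c')) => //.
- move=> c' _ [_ c'1]; suff -> : c' = 1 by exact: subgroup1.
  by apply: (ra_faithful HA) => x; rewrite group_act1; apply: c'1 => -[].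
- move=> V W kV oV kW oW VU WU VW0 PV PW c' c'VW cc'.
  have [c1 [c1V c1c]] := ra_cut HA cU kV oV VU.
  have [c2 [c2W c2c]] := ra_cut HA cU kW oW WU.
  rewrite (cut_mul HA cU VU WU VW0 cc' c1c c2c).
  by apply: subgroupM => //; [exact: PV|exact: PW].
- move=> x /Kloc[N nN KN]; exists N => // V kV oV VU VN c' c'V cc'.
  exact: (KN V).
Qed.

(** K also contains the 3-cycles fixing k x.  One of them, h, moves x away from any
    given small support; conjugating by h turns a small 3-cycle whose support
    contains x into one that fixes x. *)
Lemma subgroup_off_whole (K : gT -> Prop) x k : is_subgroup K ->
  (forall c, is_cycle c -> to c x = x -> K c) -> K k -> to k x <> x -> forall a, K a.
Proof.
move=> HK Koff Kk kx; apply: (ra_ind HA); first exact: subgroup1.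
move=> c U g cU Kg; apply: subgroupM => //; apply: (cyc_local HK cU) => z Uz.
have [|h [ih hk hx]] := @move_away _ _ _ HA x [:: to k x] [:: z; to c z; to c (to c z)].
  by rewrite inE; apply/eqP/nesym.
have hkx : to h (to k x) = to k x by apply: hk; rewrite inE.
have Kh : K h.
  have : K (k^-1 * h * k).
    apply: Koff; last by rewrite !group_actM hkx actK.
    by have := is_cycleJ HA k^-1 ih; rewrite invgK.
  move=> Kkh; rewrite -[h](mulKg k^-1) invgK -(mulgK k (_ * h)).
  by apply: subgroupM => //; apply: subgroupM => //; exact: subgroupV.
move: hx; rewrite !inE !negb_or => /and4P[_ /eqP hz /eqP hcz /eqP hccz].
have nz (f : X -> X) x' : continuous f -> x' <> f z -> \forall v \near z, x' <> f v.
  move=> cf ne; apply: (cf z [set v | x' <> v]); apply: open_nbhs_nbhs; split => //.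
  rewrite (_ : [set _ | _] = ~` [set x']); first exact: (closed_openC (@closed_point _ (ra_hausdorff HA) x')).
  by apply/seteqP; split=> y /= ?; exact: nesym.
exists [set v | [/\ to h x <> v, to h x <> to c v & to h x <> to c (to c v)]].
  have ci : continuous (id : X -> X) by move=> v; exact: cvg_id.
  have cc : continuous (fun v => to c (to c v)).
    by move=> v; apply: continuous_comp; exact: act_cont.
  move: (nz id _ ci hz) (nz _ _ (@act_cont c) hcz) (nz _ _ cc hccz).
  by apply: filterS3 => v ? ? ?; split.
move=> V c' kV oV VU VN c'V [c'1 c'2].
have c3 v : to c (to c (to c v)) = v by case: cU.
have c'hx : to c' (to h x) = to h x.
  apply: c'2 => -[] /VN [n1 n2 n3].
  - exact: n1.
  - by apply: n3; rewrite c3.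
  - by apply: n2; rewrite c3.
have : K (h^-1 * c' * h).
  apply: Koff; last by rewrite !group_actM c'hx actK.
  by have := @is_cycleJ _ _ _ HA h^-1 c'; rewrite invgK; apply; exists V.
move=> Kc; rewrite -[c'](mulKg h^-1) invgK -(mulgK h (_ * c')).
by apply: subgroupM => //; apply: subgroupM => //; exact: subgroupV.
Qed.

(** Move the points one at a time, by 3-cycles that fix those already in W. *)
Lemma gather (s : seq X) W : open W -> W !=set0 ->
  exists g, forall q, q \in s -> W (to g q).
Proof.
move=> oW W0; elim: s => [|q s [g gs]]; first by exists 1.
have [qs|qs] := boolP (q \in s).
  by exists g => q'; rewrite inE => /predU1P[->|]; exact: gs.
have [|h [_ hW hfix _]] := @move_off _ _ _ HA (to g q) (map (to g) s) [::] W oW W0.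
  by rewrite mem_map//; exact: act_inj.
exists (h * g) => q'; rewrite inE group_actM => /predU1P[->//|q's].
by rewrite hfix ?map_f//; exact: gs.
Qed.

Lemma avoid (s Z E : seq X) : (forall z, z \in Z -> z \notin s) ->
  exists h, (forall y, y \in s -> to h y = y) /\
            (forall z, z \in Z -> to h z \notin E).
Proof.
elim: Z => [|z Z IH] Zs; first by exists 1; split=> // y _; rewrite group_act1.
have [|h [hs hZ]] := IH; first by move=> y yZ; apply: Zs; rewrite inE yZ orbT.
have [zZ|zZ] := boolP (z \in Z).
  by exists h; split=> // y; rewrite inE => /predU1P[->|]; exact: hZ.
have [|k [_ kfix kz]] := @move_away _ _ _ HA (to h z) (s ++ map (to h) Z) E.
  rewrite mem_cat negb_or mem_map ?zZ ?andbT; last exact: act_inj.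
  apply/negP => hzs; have := Zs z (mem_head _ _); move: hzs.
  by move=> /[dup] hzs /hs /act_inj e; rewrite -{1}e hzs.
exists (k * h); split=> [y ys|y]; first by rewrite group_actM hs// kfix// mem_cat ys.
rewrite inE group_actM => /predU1P[->|yZ].
  by move: kz; rewrite inE negb_or => /andP[].
by rewrite kfix ?hZ// mem_cat map_f ?orbT.
Qed.

Lemma open_moved a : open [set y | to a y <> y].
Proof.
rewrite openE => y /= ay; rewrite /interior.
have /eqP ay' := ay.
have := ra_hausdorff HA; rewrite open_hausdorff => /(_ _ _ ay').
move=> [[A B] /= [Aa By] [oA oB /eqP AB0]].
rewrite !inE in Aa By.
have nA : nbhs y [set v | A (to a v)].
  by apply: open_nbhs_nbhs; split=> //; exact: (act_open act_cont).
have nB : nbhs y B by exact: open_nbhs_nbhs.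
by move: nA nB; apply: filterS2 => v /= Av Bv e; rewrite e in Av;
  rewrite -[False]/(set0 v) -AB0.
Qed.

Lemma moved_ne a : a <> 1 -> [set y | to a y <> y] !=set0.
Proof.
move=> a1; apply: contrapT => no; apply: a1; apply: (ra_faithful HA) => x.
by rewrite group_act1; apply: contrapT => ax; apply: no; exists x.
Qed.

(** Each new point is sent to a point moved by its element, outside the finite set
    of positions that would create a coincidence with the previous points. *)
Lemma place (s : seq X) (pi : X -> gT) : (forall f, f \in s -> pi f <> 1) ->
  exists d, forall f f', f \in s -> f' \in s -> to (pi f) (to d f) <> to d f'.
Proof.
elim: s => [|f s IH] pi1; first by exists 1.
have [|d ds] := IH; first by move=> y ys; apply: pi1; rewrite inE ys orbT.
have [fs|fs] := boolP (f \in s).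
  by exists d => f1 f2; rewrite !inE => /predU1P[->|f1s] /predU1P[->|f2s]; exact: ds.
pose E := [seq to d y | y <- s] ++ [seq to (pi y) (to d y) | y <- s] ++
   [seq to (pi f)^-1 (to d y) | y <- s].
have pf1 : pi f <> 1 by apply: pi1; rewrite mem_head.
have [|h [_ [mh hE] hfix _]] := @move_off _ _ _ HA (to d f) (map (to d) s) [::] _
    (open_minus (ra_hausdorff HA) E (open_moved (pi f)))
    (open_minus_ne (ra_hausdorff HA) (@ra_perfect _ _ _ HA) E (open_moved (pi f)) (moved_ne pf1)).
  by rewrite mem_map//; exact: act_inj.
move: hE; rewrite !mem_cat !negb_or => /and3P[E1 E2 E3].
exists (h * d) => f1 f2; rewrite !inE !group_actM => /predU1P[->|f1s] /predU1P[->|f2s].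
- exact: mh.
- rewrite (hfix (to d f2)) ?map_f// => e; move/negP: E3; apply.
  by apply/mapP; exists f2 => //; rewrite -e actK.
- rewrite (hfix (to d f1)) ?map_f// => e; move/negP: E2; apply.
  by apply/mapP; exists f1.
- by rewrite !hfix ?map_f//; exact: ds.
Qed.

(** Take d as in [place] and correct d^-1 by an element fixing s that moves the
    images d^-1 (pi f (d f)), which are outside s, away from E. *)
Lemma spread1 (s E : seq X) (pi : X -> gT) : (forall f, f \in s -> pi f <> 1) ->
  exists g, forall f, f \in s -> to (g * pi f * g^-1) f \notin s ++ E.
Proof.
move=> pi1; have [d dP] := place pi1.
pose Z := [seq to d^-1 (to (pi f) (to d f)) | f <- s].
have Zs z : z \in Z -> z \notin s.
  move=> /mapP[f fs ->]; apply/negP => h.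
  by apply: (dP f _ fs h); rewrite actKV.
have [h [hs hZ]] := avoid E Zs.
exists (h * d^-1) => f fs.
have hV y : y \in s -> to h^-1 y = y by move=> /hs {1}<-; rewrite actK.
rewrite invgM invgK !group_actM (hV f fs).
have fZ : to d^-1 (to (pi f) (to d f)) \in Z by apply/mapP; exists f.
rewrite mem_cat negb_or hZ// andbT; apply/negP => h1.
have := Zs _ fZ; have := hs _ h1 => /act_inj e; rewrite -e h1 => /negP; exact.
Qed.

(** By induction on n, E being the list of the images of the points of s under the
    conjugates chosen so far. *)
Lemma spread (s : seq X) (pi : X -> gT) n : (forall f, f \in s -> pi f <> 1) ->
  exists g : nat -> gT,
   (forall i f f', i < n -> f \in s -> f' \in s -> to (g i * pi f * (g i)^-1) f <> f') /\
   (forall i i' f f', i < i' < n -> f \in s -> f' \in s ->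
     to (g i * pi f * (g i)^-1) f <> to (g i' * pi f' * (g i')^-1) f').
Proof.
move=> pi1; elim: n => [|n [g [g1 g2]]].
  by exists (fun=> 1); split=> // i i' f f'; rewrite ltn0 andbF.
pose E := [seq to (g i * pi f * (g i)^-1) f | i <- iota 0 n, f <- s].
have [gn gnP] := spread1 E pi1.
exists (fun i => if i == n then gn else g i); split=> [i f f'|i i' f f'].
  rewrite ltnS leq_eqVlt; case: eqP => [_ _ fs f's|_ /= kn fs f's]; last exact: g1.
  by move=> e; have := gnP f fs; rewrite e mem_cat f's.
rewrite ltnS (leq_eqVlt i'); case: (eqVneq i' n) => [->|i'n] /=.
  move=> /andP[kn _] fs f's; rewrite (ltn_eqF kn) => e.
  have := gnP f' f's; rewrite -e mem_cat negb_or => /andP[_ /negP]; apply.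
  by apply/allpairsP; exists (i, f); split; rewrite //= mem_iota.
move=> /andP[ii' i'n'] fs f's; rewrite ltn_eqF; last exact: ltn_trans ii' i'n'.
by apply: g2 => //; rewrite ii'.
Qed.

Lemma separate_images (s : seq X) (T : seq gT) : exists O : X -> set X,
  [/\ forall x, open (O x), forall x, O x x &
     forall t t' x x' z z', t \in T -> t' \in T -> x \in s -> x' \in s ->
       to t x <> to t' x' -> O x z -> O x' z' -> to t z <> to t' z'].
Proof.
have [N [oN Nx N0]] := separate (ra_hausdorff HA) [seq to t x | t <- T, x <- s].
exists (fun x => [set z | forall t, t \in T -> N (to t x) (to t z)]); split.
- by move=> x; apply: open_forall => t _; exact: (act_open act_cont).
- by move=> x t _; exact: Nx.
- move=> t t' x x' z z' tT t'T xs x's ne /(_ t tT) Nz /(_ t' t'T) Nz' e.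
  by rewrite e in Nz; apply: (N0 _ _ _ _ _ ne Nz Nz'); apply/allpairsP;
    [exists (t, x)|exists (t', x')].
Qed.

End MovingPoints.

(** * A pigeonhole principle on a grid *)

Definition upd (I : finType) (T : Type) (c : {ffun I -> T}) i m : {ffun I -> T} :=
  [ffun j => if j == i then m else c j].

Lemma updii (I : finType) (T : Type) (c : {ffun I -> T}) i m : upd c i m i = m.
Proof. by rewrite ffunE eqxx. Qed.

(** Count the triples formed by a colour k, a point c and a value m such that the
    point obtained from c by giving the value m to the coordinate dir k has colour
    k.  Exchanging the old and the new value is an involution on the pairs (c, m),
    so their number for k is M times the number of points of colour k, and in total
    M times the size of the grid.  If each line of direction dir k had at most two
    points of colour k, it would be at most 2 * #|C| times the size of the grid. *)
Lemma monochromatic_triple (I C : finType) (M : nat) (dir : C -> I)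
    (f : {ffun I -> 'I_M} -> C) : (2 * #|C| < M)%N ->
  exists c k m1 m2 m3, [/\ m1 != m2, m2 != m3 & m3 != m1] /\
    [/\ f (upd c (dir k) m1) = k, f (upd c (dir k) m2) = k &
        f (upd c (dir k) m3) = k].
Proof.
move=> CM.
pose A c k := [pred m | f (upd c (dir k) m) == k].
have [/existsP[c /existsP[k /card_gt2P[m1 [m2 [m3 [[]]]]]]]|/existsPn small] :=
    boolP [exists c, [exists k, 2 < #|A c k|]].
  by rewrite !inE => /eqP ? /eqP ? /eqP ? ?; exists c, k, m1, m2, m3.
have small' c k : #|A c k| <= 2 by have /existsPn/(_ k) := small c; rewrite -leqNgt.
exfalso; pose n := #|{: {ffun I -> 'I_M}}|.
have n0 : 0 < n.
  by apply/card_gt0P; exists [ffun _ => Ordinal (leq_ltn_trans (leq0n _) CM)].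
have E : (\sum_k \sum_c #|A c k| = n * M)%N.
  have step k : (\sum_c #|A c k| = \sum_c (f c == k) * M)%N.
    transitivity (\sum_c \sum_m (f (upd c (dir k) m) == k : nat)).
      apply: eq_bigr => c _; rewrite -sum1_card big_mkcond /=.
      by apply: eq_bigr => m _; rewrite inE; case: eqP.
    rewrite pair_big /=.
    pose h (p : {ffun I -> 'I_M} * 'I_M) := (upd p.1 (dir k) p.2, p.1 (dir k)).
    have hK : involutive h.
      move=> [c m]; rewrite /h /= updii; congr pair.
      by apply/ffunP => j; rewrite !ffunE; case: eqP => // ->.
    rewrite (reindex_inj (inv_inj hK)) /=.
    transitivity (\sum_c \sum_(m : 'I_M) (f c == k : nat)).
      rewrite [RHS]pair_big /=; apply: eq_bigr => -[c m] _ /=.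
      congr (nat_of_bool (f _ == k)); apply/ffunP => j; rewrite !ffunE.
      by case: eqP => // ->.
    by apply: eq_bigr => c _; rewrite sum_nat_const card_ord mulnC.
  rewrite (eq_bigr _ (fun k _ => step k)) exchange_big /=.
  rewrite (eq_bigr (fun=> M)) ?sum_nat_const// => c _.
  rewrite -big_distrl /= (bigD1 (f c))//= eqxx big1 ?mul1n// => k.
  by rewrite eq_sym => /negbTE ->.
have : (n * M <= n * (2 * #|C|))%N.
  rewrite -E exchange_big /= -sum_nat_const; apply: leq_sum => c _.
  rewrite mulnC -sum_nat_const; exact: leq_sum.
by rewrite leq_pmul2l// leqNgt CM.
Qed.

(** * The colouring argument *)

Lemma comm_mul_cancel (gT : groupType) (a a' w w' : gT) :
  commute a a' -> commute a w -> commute a w' -> commute a' w -> commute a' w' ->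
  (a * w) * (a' * w') * (a * w)^-1 * (a' * w')^-1 = w * w' * w^-1 * w'^-1.
Proof.
move=> aa' aw aw' a'w a'w'.
have awV := commuteV aw; have aw'V := commuteV aw'.
have a'wV := commuteV a'w; have a'w'V := commuteV a'w'.
rewrite -[a * w * _]mulgA (mulgA w) -a'w !invgM !mulgA.
have -> : a * a' * w * w' * w^-1 * a^-1 * w'^-1 * a'^-1 =
  a * a' * (w * w' * w^-1 * w'^-1) * (a^-1 * a'^-1).
  by rewrite -!mulgA (mulgA a^-1 w'^-1) (commute_sym (commuteV (commute_sym aw'V))) !mulgA.
have c1 : commute (a * a') (w * w' * w^-1 * w'^-1).
  apply/commute_sym; do ![apply: commuteM]; apply/commute_sym;
    by do ![apply: commuteM] => //.
by rewrite c1 aa' -[X in X = _]mulgA (mulgA (a' * a)) mulgK mulgV mulg1.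
Qed.

Section Rist.
Context {gT : groupType} {X : topologicalType} {to : group_action gT X}.
Context (HA : rich_action to).
Implicit Types (a b g h : gT) (y z : X) (U V W : set X).

Definition rist U a := forall x, ~ U x -> to a x = x.

Lemma rist1 U : rist U 1. Proof. by move=> x _; rewrite group_act1. Qed.

Lemma ristM U a b : rist U a -> rist U b -> rist U (a * b).
Proof. by move=> ra rb x nU; rewrite group_actM rb// ra. Qed.

Lemma ristV U a : rist U a -> rist U a^-1.
Proof. by move=> ra x nU; rewrite -{1}(ra x nU) actK. Qed.

Lemma rist_in U a x : rist U a -> U x -> U (to a x).
Proof.
move=> ra Ux; apply: contrapT => /[dup] nU /ra /act_inj e.
by rewrite e in nU.
Qed.

Lemma rist_commute U V a b : rist U a -> rist V b ->
  (forall x, U x -> ~ V x) -> commute a b.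
Proof.
move=> ra rb UV; apply: (ra_faithful HA) => x; rewrite !group_actM.
have [Ux|nUx] := pselect (U x).
  have := UV _ Ux => nVx; have := rist_in ra Ux => /UV nVax.
  by rewrite (rb x)// (rb _ nVax).
have [Vx|nVx] := pselect (V x); last by rewrite (rb x)// (ra x)// (rb x).
have nU : ~ U (to b x) by move=> /UV; apply; exact: rist_in.
by rewrite (ra x)// (ra _ nU).
Qed.

Lemma ristJ U a (k : gT) : rist U a -> rist [set y | U (to k^-1 y)] (k * a * k^-1).
Proof. by move=> ra x /= nU; rewrite !group_actM ra// actKV. Qed.

Section Product.
Context {L : finType} (U : L -> set X).
Context (Udisj : forall l l' x, U l x -> U l' x -> l = l').
Implicit Types (e f : L -> gT) (l : L).

(** The factors commute when they are local, so the order of the product is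
    immaterial. *)
Definition rprod e := \prod_(l <- index_enum L) e l.

Definition local e := forall l, rist (U l) (e l).

Lemma localM e f : local e -> local f -> local (fun l => e l * f l).
Proof. by move=> le lf l; exact: ristM. Qed.

Lemma localV e : local e -> local (fun l => (e l)^-1).
Proof. by move=> le l; exact: ristV. Qed.

(** On the region U l only the factor e l acts: the element e l preserves U l, and
    the other factors are trivial there. *)
Lemma rprod_in e l x : local e -> U l x -> to (rprod e) x = to (e l) x.
Proof.
move=> le Ux; rewrite /rprod.
suff : forall s : seq L, uniq s ->
    to (\prod_(l <- s) e l) x = if l \in s then to (e l) x else x.
  by move=> /(_ _ (index_enum_uniq L)) ->; rewrite mem_index_enum.
elim=> [|l0 s IH] /=; first by rewrite big_nil group_act1.
move=> /andP[l0s /IH E]; rewrite big_cons group_actM E inE eq_sym.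
case: (eqVneq l0 l) => [<-|ne] /=; first by rewrite (negbTE l0s).
have key y : U l y -> to (e l0) y = y.
  by move=> Uy; apply: le => Ul0; move/eqP: ne; apply; exact: Udisj Ul0 Uy.
by case: ifP => _; apply: key => //; exact: rist_in.
Qed.

Lemma rprod_out e x : local e -> (forall l, ~ U l x) -> to (rprod e) x = x.
Proof.
move=> le nU; rewrite /rprod.
apply: (big_ind (fun a => to a x = x)) => [|a b ax bx|l _].
- exact: group_act1.
- by rewrite group_actM bx.
- exact: le.
Qed.

Lemma rprodM e f : local e -> local f ->
  rprod e * rprod f = rprod (fun l => e l * f l).
Proof.
move=> le lf; apply: (ra_faithful HA) => x; rewrite group_actM.
have lef := localM le lf.
have [[l Ux]|nU] := pselect (exists l, U l x).
  rewrite (rprod_in lf Ux) (rprod_in le (l := l)); last exact: rist_in.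
  by rewrite (rprod_in lef Ux) group_actM.
have nU' l : ~ U l x by move=> ?; apply: nU; exists l.
by rewrite (rprod_out lf)// !rprod_out.
Qed.

Lemma rprodV e : local e -> (rprod e)^-1 = rprod (fun l => (e l)^-1).
Proof.
move=> le; apply: mulg1_eq; rewrite rprodM//; last exact: localV.
by rewrite /rprod big1// => l _; rewrite mulgV.
Qed.

Lemma rprod_single e l : local e -> (forall l', l' != l -> e l' = 1) ->
  rprod e = e l.
Proof.
move=> le e1; apply: (ra_faithful HA) => x.
have [[l' Ux]|nU] := pselect (exists l, U l x).
  rewrite (rprod_in le Ux); have [->//|ne] := eqVneq l' l.
  rewrite e1// group_act1; apply/esym/le => Ul.
  by move/eqP: ne; apply; exact: Udisj Ul.
rewrite rprod_out//; first by apply/esym/le => Ul; apply: nU; exists l.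
by move=> l' Ul; apply: nU; exists l'.
Qed.

Lemma rist_rprod e (D : set L) : local e -> (forall l, ~ D l -> e l = 1) ->
  rist [set x | exists l, D l /\ U l x] (rprod e).
Proof.
move=> le e1 x /= nD.
have [[l Ux]|nU] := pselect (exists l, U l x).
  rewrite (rprod_in le Ux) e1 ?group_act1// => Dl; apply: nD; by exists l.
by apply: rprod_out => // l' Ul; apply: nU; exists l'.
Qed.

End Product.

Section Core.
Context (H : gT -> Prop) (HH : is_subgroup H) (r : nat).
Let C : finType := ('I_r * 'I_r.+1 * 'I_r.+1)%type.
(** The number of values per direction required by [monochromatic_triple] for
    the colours in C.  A colour (i, k, k') records an index of an element of the
    confining set and two indices of translates. *)
Definition nregions := (2 * #|C|)%N.+1.
(** A region is indexed by a direction, a value in this direction and a pair of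
    indices of translates: the pair k < k' needs a region of its own, where the
    elements used with the translates k and k' are sig and rho. *)
Definition region : finType := ('I_r * 'I_nregions * 'I_r.+1 * 'I_r.+1)%type.
Definition rdir (l : region) : 'I_r := l.1.1.1.

Context (q : 'I_r.+1 -> 'I_r -> gT) (U : region -> set X).
Context (conf : forall k (c : gT), exists i, H (c * q k i * c^-1)).
Context (Udisj : forall l l' x, U l x -> U l' x -> l = l').
Context (qU : forall k l l' x, U l x -> ~ U l' (to (q k (rdir l)) x)).
Context (qqU : forall k k' l l' x x', k != k' -> rdir l = rdir l' ->
  U l x -> U l' x' -> to (q k (rdir l)) x <> to (q k' (rdir l')) x').
Context (sig rho : region -> gT).
Context (sigU : local U sig) (rhoU : local U rho).

(** For c a point of the grid, x c k is the product of one factor for each region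
    whose value in its direction is that of c: this factor is sig or rho according
    to whether k is the first or the second index of the region, if any.
    Since there are more translates than directions, c gets a colour (i, k, k')
    such that H contains the conjugates of q k i and q k' i by x c k and x c k'.
    If the points with values m1, m2, m3 in direction i have this colour, quotients
    of these elements of H for m1, m2 and k, and for m1, m3 and k', have the form
    a * w, where w is local and a is supported in the translate of the regions by
    q k i or q k' i.  The factors a commute with each other and with the local
    factors, so the commutator of the two quotients is that of the local factors;
    these have in common only the value m1 of direction i, and there only the region
    with the pair (k, k') contributes. *)
Lemma colouring_core : exists l, H (sig l * rho l * (sig l)^-1 * (rho l)^-1).
Proof.
(* Only the regions with k1 < k2 are used; otherwise the pairs (k, k') and (k', k)
   would both contribute to the final commutator. *)
pose s (k : 'I_r.+1) (l : region) := let: (_, _, k1, k2) := l in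
  if k1 < k2 then (if k1 == k then sig l else if k2 == k then rho l else 1) else 1.
have sU k : local U (s k).
  move=> [[[i m] k1] k2]; rewrite /s; case: ifP => _; last exact: rist1.
  by case: ifP => _ //; case: ifP => _ //; exact: rist1.
pose e (c : {ffun 'I_r -> 'I_nregions}) k (l : region) :=
  if l.1.1.2 == c (rdir l) then s k l else 1.
have eU c k : local U (e c k).
  by move=> l; rewrite /e; case: ifP => _; [exact: sU|exact: rist1].
pose x c k := rprod (e c k).
have /choice[f fP] : forall c : {ffun 'I_r -> 'I_nregions}, exists t : C,
    t.1.2 < t.2 /\ forall k, k = t.1.2 \/ k = t.2 ->
      H (x c k * q k t.1.1 * (x c k)^-1).
  move=> c; have /choice[iota iotaP] := fun k => conf k (x c k).
  have : ~~ injectiveb iota.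
    by apply/negP => /injectiveP /leq_card; rewrite !card_ord ltnn.
  move=> /injectivePn[k [k']]; wlog kk' : k k' / k < k'.
    move=> th ne E; have [kk'|k'k] := ltnP k k'; first exact: th kk' ne E.
    apply: (th k' k) => //; last by rewrite eq_sym.
    by rewrite ltn_neqAle k'k andbT eq_sym.
  by move=> _ E; exists (iota k, k, k'); split=> //= j [] ->; rewrite // E.
have := @monochromatic_triple 'I_r C nregions (fun t => t.1.1) f (leqnn _).
move=> [c [[[i k] k'] [m1 [m2 [m3 [[m12 m23 m31] [f1 f2 f3]]]]]]] /=.
rewrite /= in f1 f2 f3.
have kk' : k < k' by have [] := fP (upd c i m1); rewrite f1.
have HX m j : f (upd c i m) = (i, k, k') -> j = k \/ j = k' ->
    H (x (upd c i m) j * q j i * (x (upd c i m) j)^-1).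
  by move=> fm jk; have [_ /(_ j)] := fP (upd c i m); rewrite fm; exact.
pose Ui := [set y : X | exists l, rdir l = i /\ U l y].
pose Uall := [set y : X | exists l, True /\ U l y].
pose qUi j := [set y : X | Ui (to (q j i)^-1 y)].
have xall m j : rist Uall (x (upd c i m) j) by apply: (rist_rprod Udisj).
pose a j m m' := q j i * ((x (upd c i m) j)^-1 * x (upd c i m') j) * (q j i)^-1.
pose w j m m' := x (upd c i m) j * (x (upd c i m') j)^-1.
have aU j m m' : rist (qUi j) (a j m m').
  apply: ristJ; rewrite /x (rprodV Udisj)// (rprodM Udisj)//; last exact: localV.
  apply: (rist_rprod Udisj) => //; first by apply: localM => //; exact: localV.
  move=> l li; have /negbTE {}li : rdir l != i by apply/eqP.
  by rewrite /e !ffunE li mulVg.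
have qUall j y : qUi j y -> ~ Uall y.
  move=> [l [li Ul]] [l' [_ Ul']]; have := qU (k := j) (l' := l') Ul.
  by rewrite li actKV; exact.
have wall j m m' : rist Uall (w j m m') by apply: ristM => //; exact: ristV.
(* The quotient splits into a far part a, supported in the translate of the
   regions in direction i, and a local part w. *)
have hE j m m' : (x (upd c i m) j * q j i * (x (upd c i m) j)^-1) *
    (x (upd c i m') j * q j i * (x (upd c i m') j)^-1)^-1 = a j m m' * w j m m'.
  have cm : commute (a j m m') (x (upd c i m) j).
    exact: rist_commute (aU _ _ _) (xall _ _) (@qUall j).
  by rewrite /w mulgA cm /a !invgM invgK !mulgA.
have Hh j m m' : f (upd c i m) = (i, k, k') -> f (upd c i m') = (i, k, k') ->
    j = k \/ j = k' -> H (a j m m' * w j m m').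
  move=> fm fm' jk; rewrite -hE; apply: subgroupM => //; first exact: HX.
  by apply: subgroupV => //; exact: HX.
have ca j j' m m' n n' : commute (a j m m') (w j' n n').
  exact: rist_commute (aU _ _ _) (wall _ _ _) (@qUall j).
have H1 := Hh k m1 m2 f1 f2 (or_introl erefl).
have H2 := Hh k' m1 m3 f1 f3 (or_intror erefl).
have caa : commute (a k m1 m2) (a k' m1 m3).
  apply: rist_commute (aU _ _ _) (aU _ _ _) _ => y [l [li Ul]] [l' [l'i Ul']].
  have kk : k != k' by rewrite -(inj_eq val_inj) /= ltn_eqF.
  apply: (qqU kk _ Ul Ul'); first by rewrite li l'i.
  by rewrite li l'i !actKV.
have := subgroupM HH (subgroupM HH (subgroupM HH H1 H2) (subgroupV HH H1))
  (subgroupV HH H2).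
rewrite comm_mul_cancel// => Hw; exists (i, m1, k, k').
have leV j m : local U (fun l => (e (upd c i m) j l)^-1) by exact: localV.
pose W j m m' l := e (upd c i m) j l * (e (upd c i m') j l)^-1.
have wE j m m' : w j m m' = rprod (W j m m').
  by rewrite /w /x (rprodV Udisj)// (rprodM Udisj).
have WU j m m' : local U (W j m m') by exact: localM.
have WV j m m' : local U (fun l => (W j m m' l)^-1) by exact: localV.
have WW j m m' j' n n' : local U (fun l => W j m m' l * W j' n n' l) by exact: localM.
have WWV j m m' j' n n' :
  local U (fun l => W j m m' l * W j' n n' l * (W j m m' l)^-1) by exact: localM.
move: Hw; rewrite !wE !(rprodV Udisj)// !(rprodM Udisj)//.
rewrite (rprod_single Udisj (l := (i, m1, k, k'))); first last.
- move=> [[[i' m] k1] k2] ne; rewrite /W /e /= !ffunE /rdir /=.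
  case: (eqVneq i' i) => [Ei|_]; last by rewrite !gsimp.
  have [Em|m_m1] := eqVneq m m1; last first.
    have [Em2|_] := eqVneq m m2.
      by rewrite Em2 (negbTE m23) !gsimp.
    by rewrite !gsimp.
  rewrite Em (negbTE m12) [m1 == m3]eq_sym (negbTE m31) !gsimp.
  rewrite /s; case: ifP => [k12|_]; last by rewrite !gsimp.
  have [E1|n1] := eqVneq k1 k.
    rewrite E1 in k12 ne *; have [E2|n2] := eqVneq k k'.
      by move: kk'; rewrite E2 ltnn.
    have [E2|n3] := eqVneq k2 k'; last by rewrite !gsimp.
    by move: ne; rewrite Ei Em E2 eqxx.
  have [E2|n2] := eqVneq k2 k; last by rewrite !gsimp.
  have [E3|n3] := eqVneq k1 k'.
    by move: k12; rewrite E2 E3 ltnNge (ltnW kk').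
  by rewrite E2 (negbTE (_ : k != k')) ?gsimp// -(inj_eq val_inj) /= ltn_eqF.
- exact: localM.
rewrite /W /e /= !ffunE /rdir /= !eqxx (negbTE m12) [m1 == m3]eq_sym (negbTE m31) !gsimp.
by rewrite /s kk' (negbTE (_ : k != k'))// -(inj_eq val_inj) /= ltn_eqF.
Qed.

End Core.
End Rist.

(** * Confined subgroups contain almost all small 3-cycles *)

Section Confined.
Context {gT : groupType} {X : topologicalType} {to : group_action gT X}.
Context (HA : rich_action to).
Implicit Types (x y z : X) (V W : set X).

Notation rist := (@rist _ _ to).

Context (H : gT -> Prop) (HH : is_subgroup H).

(** Of the finite sets that are not good, at most finitely many can be pairwise
    disjoint. *)
Definition good (F : seq X) : Prop :=
  exists U, [/\ open U, forall x, x \in F -> U x &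
    forall a b, rist U a -> rist U b -> H (a * b * a^-1 * b^-1)].

Context (P : seq gT) (P1 : forall p, p \in P -> p <> 1).
Context (conf : forall c, exists2 p, p \in P & H (c * p * c^-1)).

(** Translates of P in general position with respect to the points of all the F l
    satisfy the hypotheses of [colouring_core] on small neighbourhoods. *)
Lemma good_of_disjoint (F : region (size P) -> seq X) :
  (forall l l' x, x \in F l -> x \in F l' -> l = l') -> exists l, good (F l).
Proof.
move=> Fdisj; apply: contrapT => nogood.
pose p i := nth 1 P i.
pose s := [seq x | l <- index_enum (region (size P)), x <- F l].
have sF l x : x \in F l -> x \in s.
  by move=> xF; apply/allpairsPdep; exists l, x; rewrite mem_index_enum.
pose pi x := if [pick l | x \in F l] is Some l then p (rdir l) else 1.
have piE l x : x \in F l -> pi x = p (rdir l).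
  move=> xF; rewrite /pi; case: pickP => [l' xF'|/(_ l)]; last by rewrite xF.
  by rewrite (Fdisj _ _ _ xF xF').
have pi1 f : f \in s -> pi f <> 1.
  move=> /allpairsPdep[l [x [_ xF ->]]]; rewrite (piE l)//.
  by apply: P1; exact: mem_nth.
have [g [g1 g2]] := spread HA (size P).+1 pi1.
pose q (k : 'I_(size P).+1) (i : 'I_(size P)) := g k * p i * (g k)^-1.
pose T := 1 :: [seq q k i | k <- index_enum 'I_(size P).+1, i <- index_enum 'I_(size P)].
have qT k i : q k i \in T.
  by rewrite inE; apply/orP; right; apply/allpairsP; exists (k, i);
    rewrite !mem_index_enum.
have T1 : 1 \in T by rewrite mem_head.
have [O [oO Ox OT]] := separate_images HA s T.
pose U l := [set z | exists2 x, x \in F l & O x z].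
have oU l : open (U l).
  rewrite (_ : U l = \bigcup_(x in [set x | x \in F l]) O x); first exact: bigcup_open.
  by apply/seteqP; split=> z [x ? ?]; exists x.
have FU l x : x \in F l -> U l x by exists x.
have /choice[ab abP] : forall l, exists ab : gT * gT,
    [/\ rist (U l) ab.1, rist (U l) ab.2 & ~ H (ab.1 * ab.2 * ab.1^-1 * ab.2^-1)].
  move=> l; apply: contrapT => no; apply: nogood; exists l, (U l); split=> //.
    exact: FU.
  by move=> a b ra rb; apply: contrapT => nH; apply: no; exists (a, b).
have [||||||l Hl] := @colouring_core _ _ _ HA H HH (size P) q U _ _ _ _
    (fun l => (ab l).1) (fun l => (ab l).2).
- move=> k c; have [p0 p0P Hp0] := conf (c * g k).
  have i0 : index p0 P < size P by rewrite index_mem.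
  exists (Ordinal i0); rewrite /q /p /= nth_index// !mulgA.
  by move: Hp0; rewrite invgM !mulgA.
- move=> l l' z [x xF Oxz] [x' xF' Oxz'].
  apply: contrapT => ll'; have xx' : x <> x'.
    by move=> e; apply: ll'; apply: (Fdisj _ _ _ xF); rewrite e.
  by apply: (OT 1 1 x x' z z _ _ _ _ _ Oxz Oxz'); rewrite ?group_act1 //;
    [exact: sF xF|exact: sF xF'].
- move=> k l l' z [x xF Oxz] [x' xF' Oxz'].
  apply: (OT (q k (rdir l)) 1 x x' z _ _ _ _ _ _ Oxz Oxz'); rewrite ?group_act1//.
  + exact: sF xF.
  + exact: sF xF'.
  + by rewrite /q -(piE _ _ xF); apply: g1 => //; [exact: sF xF|exact: sF xF'].
- move=> k k' l l' z z' kk' ll' [x xF Oxz] [x' xF' Oxz'].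
  apply: (OT (q k (rdir l)) (q k' (rdir l')) x x' z z') => //; [exact: sF xF|exact: sF xF'|].
  rewrite /q -(piE _ _ xF) -(piE _ _ xF').
  have [kk|kk|/val_inj e] := ltngtP k k'; last by rewrite e eqxx in kk'.
    by apply: g2; [rewrite kk /=|exact: sF xF|exact: sF xF'].
  by apply: nesym; apply: g2; [rewrite kk /=|exact: sF xF'|exact: sF xF].
- by move=> l; have [] := abP l.
- by move=> l; have [] := abP l.
by have [] := abP l.
Qed.

(** The union of a maximal disjoint family of finite sets that are not good is
    finite. *)
Lemma finite_exceptional : exists Q : seq X,
  forall F : seq X, (forall x, x \in F -> x \notin Q) -> good F.
Proof.
apply: contrapT => noQ.
have bad (Q : seq X) : exists2 F : seq X, forall x, x \in F -> x \notin Q & ~ good F.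
  apply: contrapT => nF; apply: noQ; exists Q => F FQ.
  by apply: contrapT => nG; apply: nF; exists F.
have fam n : exists F : nat -> seq X, (forall i, i < n -> ~ good (F i)) /\
    (forall i j x, i < n -> j < n -> x \in F i -> x \in F j -> i = j).
  elim: n => [|n [F [F1 F2]]]; first by exists (fun=> [::]).
  have [F' F'Q F'bad] := bad [seq x | i <- iota 0 n, x <- F i].
  have F'F i x : i < n -> x \in F i -> x \in F' -> False.
    move=> il xF /F'Q/negP; apply; apply/allpairsPdep; exists i, x.
    by rewrite mem_iota.
  exists (fun i => if i == n then F' else F i); split=> [i|i j x].
    by rewrite ltnS leq_eqVlt; case: eqP => //= _; exact: F1.
  rewrite !ltnS (leq_eqVlt i) (leq_eqVlt j).
  case: (eqVneq i n) => [->|_] /=; case: (eqVneq j n) => [->|_] //=.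
  - by move=> _ jn xF' xF; case: (F'F j x).
  - by move=> il _ xF xF'; case: (F'F i x).
  - exact: F2.
have [F [F1 F2]] := fam #|region (size P)|.
have [|l] := @good_of_disjoint (fun l => F (enum_rank l)).
  move=> l l' x xF xF'; apply: enum_rank_inj; apply: val_inj.
  by apply: F2 xF xF'; exact: ltn_ord.
exact: F1.
Qed.

End Confined.

Section OffExceptional.
Context {gT : groupType} {X : topologicalType} {to : group_action gT X}.
Context (HA : rich_action to).
Implicit Types (x y z : X) (V W : set X).

Let act_cont := ra_cont HA.
Notation germ_eq := (germ_eq to).
Notation is_cycle := (@is_cycle _ _ to).

(** Here d is the 3-cycle (V, c V, d (d V)), while k maps c V to c (c V) like c does,
    and is trivial on V and d (d V).  Conjugating d^-1 by k gives the 3-cycle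
    (V, d (d V), c (c V)), and its product with d is (V, c V, c (c V)), which is c. *)
Lemma three_cycle_commutator (c d k : gT) V : three_cycle to c V -> three_cycle to d V ->
  (forall z, V z -> [/\ to d z = to c z, to k (to c z) = to c (to c z), to k z = z,
    to k (to d (to d z)) = to d (to d z) &
    to c (to d (to d z)) = to d (to d z)]) ->
  c = k * d^-1 * k^-1 * d^-1^-1.
Proof.
move=> cV dV zP; rewrite invgK; apply: (ra_faithful HA) => y.
case: (cV) (dV) => _ _ dcV c3 _ [_ _ ddV d3 _].
pose e := k * d^-1 * k^-1.
have dVE u : to d^-1 u = to d (to d u) by rewrite -{1}(d3 u) actK.
have kV z : V z -> to k^-1 z = z by move=> /zP[_ _ kz _ _]; rewrite -{1}kz actK.
have kdV z : V z -> to k^-1 (to d (to d z)) = to d (to d z).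
  by move=> /zP[_ _ _ kz _]; rewrite -{1}kz actK.
have eV : three_cycle to e V.
  have := three_cycleJ act_cont k (three_cycleV dV).
  rewrite (_ : [set z | V (to k^-1 z)] = V)//.
  apply/seteqP; split=> z /= Vz; last by rewrite kV.
  by have [_ _ + _ _] := zP _ Vz; rewrite actKV => ->.
have e1 z : V z -> to e z = to d (to d z).
  by move=> Vz; rewrite !group_actM kV// dVE; have [] := zP _ Vz.
have e2 z : V z -> to e (to e z) = to c (to c z).
  by move=> Vz; rewrite (e1 z Vz) /e !group_actM kdV// actK; have [-> ->] := zP _ Vz.
case: (eV) => _ _ deV e3 _.
rewrite group_actM -/e.
have [Sd|nSd] := pselect (cycle_support to d V y).
  case: Sd => Vy.
  - have [E _ _ _ _] := zP _ Vy; rewrite E; apply/esym/(three_cycle_fix eV) => -[] Vz.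
    + exact: dcV Vz.
    + have := e2 _ Vz; rewrite e3 => /act_inj E'; apply: (dcV _ Vz).
      by rewrite -E'.
    + have := e1 _ Vz; rewrite e3 -{1}E => /act_inj E'; apply: (ddV _ Vz).
      by rewrite -E'.
  - have [_ _ _ _ E] := zP _ Vy; rewrite e1// -{1}(d3 y) E.
    by rewrite !d3.
  - have [E1 E2 _ _ _] := zP _ Vy; set z := to d (to d y) in Vy E1 E2.
    have Ey : y = to c z by rewrite -E1 /z d3.
    have E3 : to d (to c z) = to e z by rewrite e1// E1.
    by rewrite Ey E3 e2.
have [Sc|nSc] := pselect (cycle_support to c V y).
  rewrite (three_cycle_fix dV nSd); case: Sc => Vy.
  - by case: nSd; constructor 1.
  - by have := e2 _ Vy; rewrite c3 => {2}<-; rewrite e3.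
  - case: nSd; have [E _ _ _ _] := zP _ Vy; rewrite c3 in E.
    by constructor 3; rewrite -{1}E d3.
rewrite (three_cycle_fix dV nSd) (three_cycle_fix cV nSc); apply/esym/(three_cycle_fix eV) => -[] Vy.
- by apply: nSd; constructor 1.
- by apply: nSc; have := e2 _ Vy; rewrite e3 => E; constructor 2; rewrite /= {1}E c3.
- by apply: nSd; have := e1 _ Vy; rewrite e3 => E; constructor 2; rewrite {1}E d3.
Qed.

Context (H : gT -> Prop) (HH : is_subgroup H).

(** Near a moved point x, c is a commutator as in the previous lemma, of elements
    supported near the points x, c x, c (c x) and two further points; the latter
    can be chosen outside Q. *)
Lemma good_cyc_off (Q : seq X) c : (forall F : seq X,
    (forall x, x \in F -> x \notin Q) -> good (to := to) H F) ->
  is_cycle c -> (forall x, x \in Q -> to c x = x) -> H c.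
Proof.
move=> goodQ ic cQ; have [U cU] := ic; apply: (cyc_local HA HH cU) => x Ux.
have c3 : forall z, to c (to c (to c z)) = z by case: cU.
have cx : to c x <> x by apply: (three_cycle_ne cU); constructor 1.
have movQ z : to c z <> z -> z \notin Q by move=> cz; apply/negP => /cQ.
have ccx : to c (to c x) <> to c x by move/act_inj.
have cccx : to c (to c (to c x)) <> to c (to c x) by rewrite c3 => /esym/(is_cycle_ne2 ic cx).
have ccx' : to c (to c x) <> x by exact: is_cycle_ne2.
set y := to c x in cx ccx cccx ccx' *; set w := to c y in ccx cccx ccx' *.
have [|h [ih hfix hw]] := @move_away _ _ _ HA w [:: x; y] Q.
  by rewrite !inE negb_or; apply/andP; split; apply/eqP.
have hx : to h x = x by apply: hfix; rewrite !inE eqxx.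
have hy : to h y = y by apply: hfix; rewrite !inE eqxx orbT.
have hV z : to h z = z -> to h^-1 z = z by move=> {1}<-; rewrite actK.
(* The 3-cycle d has the germ of c at x, but a third point v different from w and
   outside Q. *)
pose d := h * c * h^-1.
have id : is_cycle d by exact: (is_cycleJ HA).
have dx : to d x = y by rewrite !group_actM hV.
have ddx : to d (to d x) = to h w by rewrite dx !group_actM (hV y).
set v := to h w in ddx hw.
have gd : germ_eq d c x.
  have gh : germ_eq h^-1 1 x by apply: (is_cycle_fix_germ HA); [exact: is_cycleV|exact: hV].
  rewrite -[c in germ_eq _ c]mulg1; apply: (@germ_trans _ _ _ (c * h^-1)); last exact: germ_mulr.
  rewrite /d -mulgA -[X in germ_eq _ X]mul1g; apply: (germ_mull act_cont).
  by apply: (is_cycle_fix_germ HA) => //; rewrite group_actM hV.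
clearbody d.
move: hw; rewrite inE negb_or => /andP[/eqP vw vQ].
have vx : v <> x by rewrite /v -hx => /act_inj.
have vy : v <> y by rewrite /v -hy => /act_inj.
have xQ := movQ _ cx; have yQ := movQ _ ccx; have wQ := movQ _ cccx.
(* The 3-cycle k has the germ of c at y, and fixes Q so that its third point is
   outside Q, too. *)
have [|||k [ik gk kfix]] := @germ_cycle _ _ _ HA c y (x :: v :: Q).
- exact: ccx.
- by rewrite !inE !negb_or yQ andbT; apply/andP; split; apply/eqP => //; exact: nesym.
- by rewrite !inE !negb_or wQ andbT; apply/andP; split; apply/eqP => //; exact: nesym.
have kx : to k x = x by apply: kfix; rewrite !inE eqxx.
have kv : to k v = v by apply: kfix; rewrite !inE eqxx orbT.
have ky : to k y = w by rewrite (germ_at gk).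
have kw : to k w <> w by rewrite -{2}ky => /act_inj; exact: ccx.
have kwQ : to k w \notin Q.
  apply/negP => h1; apply: kw; apply: (@act_inj _ _ to k).
  by rewrite kfix// !inE h1 !orbT.
have [|W [oW WF WH]] := goodQ [:: x; y; w; v; to k w].
  by move=> z; rewrite !inE => /or4P[/eqP->|/eqP->|/eqP->|/orP[]/eqP->].
have [[Ud0 dU0] [Uk0 kU0]] := (id, ik).
have [Ud [dU Udx]] : exists U', three_cycle to d U' /\ U' x by apply: cyc_at dU0 _; rewrite // dx.
have [Uk [kU Uky]] : exists U', three_cycle to k U' /\ U' y by apply: cyc_at kU0 _; rewrite // ky.
(* As c v differs from x, the 3-cycle c restricted to a small base is trivial on
   the third piece of d. *)
have [O [oO Ox OT]] := separate_images HA [:: x] [:: c * d * d; 1].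
have n1 : \forall z \near x, to k (to c z) = to c (to c z).
  have : germ_eq (k * c) (c * c) x by exact: (germ_mull act_cont).
  by apply: filterS => z; rewrite !group_actM.
have n2 : \forall z \near x, to k z = z.
  by have := is_cycle_fix_germ HA ik kx; apply: filterS => z; rewrite group_act1.
have n3 : \forall z \near x, to k (to d (to d z)) = to d (to d z).
  have : germ_eq (k * (d * d)) (1 * (d * d)) x.
    apply: (germ_mull act_cont); rewrite group_actM ddx; exact: (is_cycle_fix_germ HA).
  by apply: filterS => z; rewrite mul1g !group_actM.
have nW (a : gT) (B : set X) : open B -> B (to a x) -> \forall z \near x, B (to a z).
  move=> oB Bx; apply: open_nbhs_nbhs; split=> //; exact: (act_open act_cont).
have [Wx Wy Ww Wv Wkw] : [/\ W x, W y, W w, W v & W (to k w)].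
  by split; apply: WF; rewrite !inE eqxx ?orbT.
have m1 := nW 1 W oW; have m2 := nW c W oW; have m3 := nW (c * c) W oW.
have m4 := nW (d * d) W oW; have m5 := nW (k * (c * c)) W oW.
have m6 := nW 1 (O x) (oO x); have m7 := nW 1 Ud; have m8 := nW c Uk.
rewrite !group_act1 in m1 m6 m7; rewrite !group_actM in m3 m4 m5.
rewrite ddx in m4.
exists [set z | [/\ to d z = to c z, to k (to c z) = to c (to c z), to k z = z &
   to k (to d (to d z)) = to d (to d z)] /\
   ([/\ W z, W (to c z) & W (to c (to c z))] /\
   (W (to d (to d z)) /\ W (to k (to c (to c z))) /\ [/\ O x z, Ud z & Uk (to c z)]))].
  near=> z; split; first by split; near: z.
  split; first by split; near: z;
    [have := m1 Wx|exact: m2|have := m3 Ww]; apply: filterS => u; rewrite ?group_act1 ?group_actM.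
  split; first by near: z; have := m4 Wv; apply: filterS => u; rewrite !group_actM.
  split; first by near: z; have := m5 Wkw; apply: filterS => u; rewrite !group_actM.
  split; near: z; [have := m6 (Ox x)|have := m7 _ Udx|]; last by apply: m8 => //; case: kU.
    by apply: filterS => u; rewrite group_act1.
  by case: dU => _ oUd _ _ _ /(_ oUd); apply: filterS => u; rewrite group_act1.
move=> V c' kV oV VU VN cV' cc'.
have VUd : V `<=` Ud by move=> z /VN[_ [_ [_ [_ []]]]].
have [d' [dV' dd']] := ra_cut HA dU kV oV VUd.
pose cV := [set z | V (to c^-1 z)].
have cVUk : cV `<=` Uk by move=> z /VN[_ [_ [_ [_ [_ _]]]]]; rewrite actKV.
have [k' [kV' kk']] := ra_cut HA kU (act_compact act_cont kV) (act_open act_cont _ oV) cVUk.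
have [_ _ ddV d3' _] := dV'.
have d3 z : to d (to d (to d z)) = z by case: dU.
have k3 z : to k (to k (to k z)) = z by case: kU.
have cutfix a b B z : is_cut to a B b -> to a z = z -> to b z = z.
  by move=> [ab1 ab2] az; have [/ab1->|/ab2] := pselect (cycle_support to a B z).
have d'z z : V z -> to d' z = to d z by move=> Vz; apply: dd'.1; constructor 1.
have d'dz z : V z -> to d' (to d' z) = to d (to d z).
  by move=> Vz; rewrite (d'z z Vz) dd'.1//; rewrite /cycle_support /= d3; constructor 3.
have zP z : V z -> [/\ to d' z = to c' z, to k' (to c' z) = to c' (to c' z), to k' z = z,
    to k' (to d' (to d' z)) = to d' (to d' z) &
    to c' (to d' (to d' z)) = to d' (to d' z)].
  move=> Vz; have [[e1 e2 e3 e4] [_ [_ [_ [Oz _ _]]]]] := VN _ Vz.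
  have c'z : to c' z = to c z by apply: cc'.1; constructor 1.
  have c'cz : to c' (to c z) = to c (to c z).
    by apply: cc'.1; rewrite /cycle_support /= c3; constructor 3.
  split.
  - by rewrite (d'z z Vz) e1.
  - by rewrite c'z c'cz kk'.1//; constructor 1; rewrite /= /cV /= actK.
  - exact: cutfix kk' _.
  - by rewrite (d'dz z Vz); exact: cutfix kk' _.
  rewrite (d'dz z Vz); apply: cc'.2 => -[] Vz'.
  - by apply: (ddV _ Vz'); rewrite d'z// d3.
  - have [_ [_ [_ [_ [Oz' _ _]]]]] := VN _ Vz'.
    apply: (OT (c * d * d) 1 x x _ _ _ _ _ _ _ Oz Oz'); rewrite ?inE ?eqxx ?orbT//.
      rewrite group_act1 !group_actM ddx => cv; apply: vw.
      by rewrite -(c3 v) cv.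
    by rewrite group_act1 !group_actM.
  - set z' := to c (to c (to d (to d z))) in Vz'.
    have [[e1' _ _ _] _] := VN _ Vz'.
    have e : to d z' = to d (to d z) by rewrite e1' /z' c3.
    by apply: (ddV _ Vz); rewrite (d'z z Vz) -(act_inj e).
rewrite (three_cycle_commutator cV' dV' zP); apply: WH.
- move=> z nWz; apply: kk'.2 => -[] /VN[[_ e _ _] [[_ W2 W3] [_ [W5 _]]]]; apply: nWz.
  + by move: W2; rewrite actKV.
  + by move: W5 e; rewrite !actKV => W5 e; rewrite -e k3 in W5.
  + by move: W3 e; rewrite !actKV => W3 e; rewrite -e k3 in W3.
- apply: ristV => z nWz; apply: dd'.2 => -[] /VN[[e1 _ _ _] [[W1 W2 _] [W4 _]]]; apply: nWz.
  + exact: W1.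
  + by move: W4; rewrite d3.
  + by move: W2; rewrite -e1 d3.
Unshelve. all: by end_near. Qed.

End OffExceptional.

(** * The unit space *)

Section OpenEmbedding.
Context {Y : topologicalType} (f : Y -> cantor_space).
Context (f_cont : continuous f) (f_inj : injective f).
Context (f_open : forall O, open O -> open (f @` O)).

Lemma embedded_base (O : set Y) y : open O -> O y ->
  exists B, [/\ compact B, open B, B y & B `<=` O].
Proof.
move=> oO Oy.
have nO : nbhs (f y) (f @` O).
  by apply: open_nbhs_nbhs; split; [exact: f_open|exists y].
have [D [Dy [oD cD]] DO] := zero_dimensional_cvg cantor_space_hausdorff
  cantor_zero_dimensional cantor_space_compact nO.
have fO z : D (f z) -> O z by move=> /DO[z' Oz' /f_inj <-].
exists (f @^-1` D); split=> //; last 1 first.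
- by apply: open_comp => // z _; exact: f_cont.
have kD : compact D by apply: (subclosed_compact cD cantor_space_compact).
move=> F PF FD.
have [//|b [Db clb]] := kD (f @ F) _.
have [z Oz fz] := DO b Db.
exists z; split; first by rewrite /= fz.
move=> A N FA; rewrite nbhsE => -[N' [oN' N'z] N'N].
have FA' : F [set u | (f @` A) (f u)] by move: FA; apply: filterS => u Au; exists u.
have [||_ [[a Aa <-] [n N'n /f_inj e]]] := clb (f @` A) (f @` N').
- exact: FA'.
- by rewrite -fz; apply: open_nbhs_nbhs; split; [exact: f_open|exists z].
by exists a; split=> //; apply: N'N; rewrite -e.
Qed.

Lemma embedded_perfect (y : Y) : ~ open [set y].
Proof.
move=> /f_open; rewrite image_set1; exact: (perfectTP.1 cantor_perfect).
Qed.

End OpenEmbedding.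

Lemma cantor_open_embedding (Y : topologicalType) : is_cantor_space Y ->
  compact [set: Y] /\ exists f : Y -> cantor_space,
    [/\ continuous f, injective f & forall O, open O -> open (f @` O)].
Proof.
move=> [f [h [fK hK cf ch]]]; split.
  rewrite (_ : [set: Y] = h @` setT).
    by apply: continuous_compact; [exact: continuous_subspaceT|exact: cantor_space_compact].
  by apply/seteqP; split=> // y _; exists (f y).
exists f; split=> //; first exact: can_inj fK.
move=> O oO; rewrite (_ : f @` O = h @^-1` O).
  by apply: open_comp => // z _; exact: ch.
apply/seteqP; split=> [_ [y Oy <-]|z Oz]; first by rewrite /= fK.
by exists (h z).
Qed.

Lemma lc_cantor_open_embedding (Y : topologicalType) : is_lc_noncompact_cantor_space Y ->
  ~ compact [set: Y] /\ exists f : Y -> cantor_space,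
    [/\ continuous f, injective f & forall O, open O -> open (f @` O)].
Proof.
move=> [U [oU ncU [f [h [fK hK cf ch]]]]].
have cval : continuous (set_val : U -> cantor_space) by exact: initial_continuous.
have cvf : continuous (fun y => set_val (f y)).
  by move=> y; apply: continuous_comp; [exact: cf|exact: cval].
split.
  move=> kY; apply: ncU; apply: (compact_closed cantor_space_hausdorff).
  rewrite (_ : U = (fun y => set_val (f y)) @` setT).
    by apply: continuous_compact => //; exact: continuous_subspaceT.
  apply/seteqP; split=> [z Uz|_ [y _ <-]]; last exact: set_valP.
  by exists (h (exist _ z (mem_set Uz))) => //; rewrite hK.
exists (fun y => set_val (f y)); split=> //.
  by move=> y y' /val_inj /(can_inj fK).
move=> O oO.
have : open (h @^-1` O) by apply: open_comp => // z _; exact: ch.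
move=> [W oW WE].
rewrite (_ : _ @` O = W `&` U); first exact: openI.
apply/seteqP; split=> [_ [y Oy <-]|z [Wz Uz]].
  split; last exact: set_valP.
  suff : (set_val @^-1` W) (f y) by [].
  by rewrite WE /= fK.
exists (h (exist _ z (mem_set Uz))); last by rewrite hK.
suff : (h @^-1` O) (exist _ z (mem_set Uz)) by [].
by rewrite -WE.
Qed.

(** * The alternating group of a groupoid acts richly *)

Section FullGroup.
Context {X : topologicalType} (G : etale_groupoid X).
Implicit Types (T : set G) (S : set X) (g h k : G) (x y : X).

Lemma full_arrow T x : full_bisection T -> exists2 g, T g & src g = x.
Proof. by case=> _ /seteqP[_ /(_ x I)[g Tg <-]] _; exists g. Qed.

Lemma tau_src T g x : full_bisection T -> T g -> src g = x -> tau T x = rng g.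
Proof. by move=> fT Tg <-; exact: tauE. Qed.

Lemma tau_continuous T : full_bisection T -> continuous (tau T).
Proof.
move=> fT; have /full_bisectionP[oT [hs [hr [[chs _] hsT _ _ _]]]] := fT.
have -> : tau T = fun x => rng (hs x).
  by apply/funext => x; have [Th hx] := hsT x; exact: tau_src.
by move=> x; apply: continuous_comp; [exact: chs|exact: rng_continuous].
Qed.

(** The continuity of the two sections is automatic, because the source and range
    maps are open. *)
Lemma full_bisection_intro T : open T ->
  (forall x, exists2 g, T g & src g = x) -> (forall x, exists2 g, T g & rng g = x) ->
  {in T &, injective (src : G -> X)} -> {in T &, injective (rng : G -> X)} ->
  full_bisection T.
Proof.
move=> oT sP rP sinj rinj.
have /choice[hs hsP] : forall x, exists g, T g /\ src g = x.
  by move=> x; have [g] := sP x; exists g.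
have /choice[hr hrP] : forall x, exists g, T g /\ rng g = x.
  by move=> x; have [g] := rP x; exists g.
have sK g : T g -> hs (src g) = g.
  by move=> Tg; have [Th e] := hsP (src g); apply: sinj; rewrite ?inE.
have rK g : T g -> hr (rng g) = g.
  by move=> Tg; have [Th e] := hrP (rng g); apply: rinj; rewrite ?inE.
apply/full_bisectionP; split=> //; exists hs, hr; split=> //; split=> x.
- have [Th _] := hsP x => O; rewrite nbhsE => -[O' [oO' O'h] O'O].
  have : nbhs x (src @` (O' `&` T)).
    apply: open_nbhs_nbhs; split; first exact: src_open (openI oO' oT).
    by exists (hs x) => //; have [] := hsP x.
  by apply: filterS => _ [g [O'g Tg] <-] /=; rewrite sK//; exact: O'O.
- have [Th _] := hrP x => O; rewrite nbhsE => -[O' [oO' O'h] O'O].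
  have : nbhs x (rng @` (O' `&` T)).
    apply: open_nbhs_nbhs; split; first exact: rng_open (openI oO' oT).
    by exists (hr x) => //; have [] := hrP x.
  by apply: filterS => _ [g [O'g Tg] <-] /=; rewrite rK//; exact: O'O.
Qed.

Lemma units_open : open (range (gunit G)).
Proof. by have [[]] := bis_one_full G. Qed.

Lemma src_open_preim (U : set X) : open U -> open [set g : G | U (src g)].
Proof. by move=> oU; apply: open_comp => // g _; exact: src_continuous. Qed.

Lemma rng_open_preim (U : set X) : open U -> open [set g : G | U (rng g)].
Proof. by move=> oU; apply: open_comp => // g _; exact: rng_continuous. Qed.

Lemma bis_inv_open T : open T -> open (bis_inv T).
Proof.
move=> oT; have -> : bis_inv T = (ginv : G -> G) @^-1` T.
  by apply/seteqP; split=> g /bis_invE.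
by apply: open_comp => // g _; exact: ginv_continuous.
Qed.

Definition with_units T (S : set X) : set G :=
  T `|` [set g | range (gunit G) g /\ ~ S (src g)].

Lemma with_units_full T (S : set X) : open T -> closed S ->
  (forall g, T g -> S (src g) /\ S (rng g)) ->
  (forall x, S x -> exists2 g, T g & src g = x) ->
  (forall x, S x -> exists2 g, T g & rng g = x) ->
  {in T &, injective (src : G -> X)} -> {in T &, injective (rng : G -> X)} ->
  full_bisection (with_units T S).
Proof.
move=> oT cS TS sT rT si ri; apply: full_bisection_intro.
- apply: openU => //; apply: openI; first exact: units_open.
  by apply: (@src_open_preim (~` S)); exact: closed_openC.
- move=> x; have [/sT[g Tg gx]|nS] := pselect (S x); first by exists g => //; left.
  by exists (gunit G x); rewrite ?src_unit//; right; split; [exists x|rewrite src_unit].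
- move=> x; have [/rT[g Tg gx]|nS] := pselect (S x); first by exists g => //; left.
  by exists (gunit G x); rewrite ?rng_unit//; right; split; [exists x|rewrite src_unit].
- move=> g h; rewrite !inE => -[Tg|[[x _ <-] nS]] [Th|[[y _ <-] nS']].
  + by apply: si; rewrite inE.
  + by have [Sg _] := TS _ Tg => e; case: nS'; rewrite -e.
  + by have [Sh _] := TS _ Th => e; case: nS; rewrite e.
  + by rewrite !src_unit => ->.
- move=> g h; rewrite !inE => -[Tg|[[x _ <-] nS]] [Th|[[y _ <-] nS']].
  + by apply: ri; rewrite inE.
  + have [_ Sg] := TS _ Tg => e; case: nS'.
    by rewrite src_unit; rewrite rng_unit in e; rewrite -e.
  + have [_ Sh] := TS _ Th => e; case: nS.
    by rewrite src_unit; rewrite rng_unit in e; rewrite e.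
  + by rewrite !rng_unit => ->.
Qed.

Lemma with_units_tau T S x : full_bisection (with_units T S) -> ~ S x ->
  tau (with_units T S) x = x.
Proof.
move=> fT nS; rewrite (tau_src fT (g := gunit G x)) ?src_unit ?rng_unit//.
by right; split; [exists x|rewrite src_unit].
Qed.

Lemma local_bisection g : exists T, [/\ open T, T g,
  {in T &, injective (src : G -> X)} & {in T &, injective (rng : G -> X)}].
Proof.
have [U [oU Ug _ [_ [u [uK _]]]]] := src_local_homeo g.
have [V [oV Vg _ [_ [v [vK _]]]]] := rng_local_homeo g.
exists (U `&` V); split=> //; first exact: openI.
- by move=> a b; rewrite !inE => -[Ua _] [Ub _] e; rewrite -(uK a) ?inE// e uK ?inE.
- by move=> a b; rewrite !inE => -[_ Va] [_ Vb] e; rewrite -(vK a) ?inE// e vK ?inE.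
Qed.

(** Acting by T and by its inverse, and trivially elsewhere, gives an involution. *)
Lemma swap_exists T : open T ->
  {in T &, injective (src : G -> X)} -> {in T &, injective (rng : G -> X)} ->
  closed (src @` T) -> closed (rng @` T) ->
  (forall g h, T g -> T h -> src g <> rng h) ->
  exists u : full_group G, [/\ T `<=` val u,
    forall g, T g -> tau (val u) (src g) = rng g,
    forall g, T g -> tau (val u) (rng g) = src g,
    forall x, ~ (src @` T) x -> ~ (rng @` T) x -> tau (val u) x = x &
    forall x, ~ (src @` T) x -> ~ (rng @` T) x -> val u (gunit G x)].
Proof.
move=> oT si ri cs cr sr.
pose T' := T `|` bis_inv T; pose S := src @` T `|` rng @` T.
have fT : full_bisection (with_units T' S).
  apply: with_units_full.
  - by apply: openU => //; exact: bis_inv_open.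
  - exact: closedU.
  - move=> g [Tg|/bis_invE Tg]; first by split; [left|right]; exists g.
    by split; [right|left]; exists (ginv g); rewrite ?rng_inv ?src_inv.
  - move=> x [[g Tg <-]|[g Tg <-]]; first by exists g => //; left.
    by exists (ginv g); rewrite ?src_inv//; right; exists g.
  - move=> x [[g Tg <-]|[g Tg <-]]; last by exists g => //; left.
    by exists (ginv g); rewrite ?rng_inv//; right; exists g.
  - move=> g h; rewrite !inE => -[Tg|[g' Tg <-]] [Th|[h' Th <-]].
    + by apply: si; rewrite inE.
    + by rewrite src_inv => /sr; case.
    + by rewrite src_inv => /esym/sr; case.
    + by rewrite !src_inv => /ri ->//; rewrite inE.
  - move=> g h; rewrite !inE => -[Tg|[g' Tg <-]] [Th|[h' Th <-]].
    + by apply: ri; rewrite inE.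
    + by rewrite rng_inv => /esym/sr; case.
    + by rewrite rng_inv => /sr; case.
    + by rewrite !rng_inv => /si ->//; rewrite inE.
exists (full_of fT); split=> /=.
- by move=> g Tg; left; left.
- by move=> g Tg; apply: (tau_src fT) => //; left; left.
- move=> g Tg; rewrite -[RHS]rng_inv; apply: (tau_src fT); rewrite ?src_inv//.
  by left; right; exists g.
- by move=> x n1 n2; apply: with_units_tau => // -[].
- by move=> x n1 n2; right; split; [exists x|rewrite src_unit => -[]].
Qed.

Context (Geff : effective_groupoid G).

Lemma full_group_eq (u v : full_group G) :
  (forall x, tau (val u) x = tau (val v) x) -> u = v.
Proof.
move=> e; apply: val_inj; have [bu su _] := full_groupP u.
have [bv sv _] := full_groupP v.
by apply: Geff => //; rewrite su sv.
Qed.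

Notation A := (alternating_group G).
Notation to := (alternating_action G).

Lemma alternating_faithful (a b : A) : (forall x, to a x = to b x) -> a = b.
Proof. by move=> e; apply: val_inj; exact: full_group_eq. Qed.

Lemma alternating_continuous (a : A) : continuous (to a).
Proof. exact: tau_continuous (full_groupP _). Qed.

(** The base is allowed to be empty, in which case u = 1 by effectiveness. *)
Lemma alternating_of (u : full_group G) (B : set X) : compact B -> open B ->
  (forall x, B x -> ~ B (tau (val u) x)) ->
  (forall x, tau (val u) (tau (val u) (tau (val u) x)) = x) ->
  (forall x, ~ B x -> ~ B (tau (val u) x) -> ~ B (tau (val u) (tau (val u) x)) ->
     tau (val u) x = x) ->
  exists a : A, val a = u /\ three_cycle to a B.
Proof.
move=> kB oB dB u3 fixu.
have cu : continuous (tau (val u)) := tau_continuous (full_groupP u).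
suff Au : generated_subgroup (@is_3cycle X G) u.
  by exists (exist _ u (mem_set Au)).
have [[x Bx]|B0] := pselect (B !=set0); last first.
  have -> : u = 1.
    apply: full_group_eq => x; rewrite tau1; apply: fixu => Bx; apply: B0;
      by [exists x|exists (tau (val u) x)|exists (tau (val u) (tau (val u) x))].
  by have [] := generated_subgroup_closed (@is_3cycle X G); rewrite inE.
apply: sub_gen_smallest; split.
- by move=> u1; apply: (dB x Bx); rewrite u1 tau1.
- apply: full_group_eq => y; rewrite tau1 -[RHS]u3.
  by rewrite expgS expg2 !tauM.
have imE (D : set X) : tau (val u) @` D = [set y | D (tau (val u) (tau (val u) y))].
  apply/seteqP; split=> [_ [z Dz <-]|y Dy]; first by rewrite /= u3.
  by exists (tau (val u) (tau (val u) y)).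
have kim (D : set X) : compact D -> compact (tau (val u) @` D).
  by move=> kD; apply: continuous_compact => //; exact: continuous_subspaceT.
have oim (D : set X) : open D -> open (tau (val u) @` D).
  move=> oD; rewrite imE; apply: open_comp => // z _.
  by apply: (@continuous_comp _ _ _ (tau (val u)) (tau (val u))); exact: cu.
exists B, (tau (val u) @` B), (tau (val u) @` (tau (val u) @` B)).
split=> //.
- by split=> //; [exact: kim|exact/kim/kim].
- by split=> //; [exact: oim|exact/oim/oim].
- split; apply/seteqP; split=> // y.
  + by move=> [By [z Bz zy]]; apply: (dB z Bz); rewrite zy.
  + rewrite [X in _ `&` X]imE => -[[z Bz zy] [z' Bz' /=]]; rewrite -zy u3 => e.
    by apply: (dB _ Bz'); rewrite e.
  + rewrite imE imE => -[By] /=; rewrite u3 => Buy; exact: (dB _ By).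
- split=> //; apply/seteqP; split=> y /=.
    by move=> [_ [_ [z Bz <-] <-] <-]; rewrite u3.
  move=> By; exists (tau (val u) (tau (val u) y)) => //.
  by exists (tau (val u) y) => //; exists y.
- move=> y ny; apply: fixu => By; apply: ny.
  + by left; left.
  + by right; rewrite imE imE /= u3.
  + by left; right; rewrite imE.
Qed.

Lemma alternating_is_three_cycle (a : A) : is_3cycle (val a) -> exists U, three_cycle to a U.
Proof.
move=> [_ a3 [U1 [U2 [U3 [[k1 _ _] [o1 _ _] [d12 d23 d13] [i1 i2 i3] afix]]]]].
have t3 x : to a (to a (to a x)) = x.
  have : tau (val (val a ^+ 3)) x = x by rewrite a3 tau1.
  by rewrite expgS expg2 !tauM.
have t1 x : U1 x -> U2 (to a x) by move=> Ux; rewrite -i1; exists x.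
have t2 x : U2 x -> U3 (to a x) by move=> Ux; rewrite -i2; exists x.
have t3' x : U3 x -> U1 (to a x) by move=> Ux; rewrite -i3; exists x.
exists U1; split=> //.
- by move=> x /t1 Ux Ux'; rewrite -[False]/(set0 (to a x)) -d12.
- move=> x n1 n2 n3; apply: afix => -[[//|Ux]|Ux].
    by apply/n3/t3'/t2.
  by apply/n2/t3'.
Qed.

(** The elements that preserve P under left multiplication, together with their
    inverses, form a subgroup containing the 3-cycles. *)
Lemma alternating_ind (P : A -> Prop) : P 1 ->
  (forall (c : A) U (g : A), three_cycle to c U -> P g -> P (c * g)) -> forall g : A, P g.
Proof.
move=> P1 PM.
(* The condition on the inverse makes this set stable under inversion. *)
pose M := [set u : full_group G | exists a : A, [/\ val a = u,
  forall g : A, P g -> P (a * g) & forall g : A, P g -> P (a^-1 * g)]].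
suff sub : generated_subgroup (@is_3cycle X G) `<=` M.
  move=> g; have [a [ag aP _]] := sub (val g) (set_mem (valP g)).
  by rewrite -(val_inj ag) -[a]mulg1; exact: aP.
apply: smallest_sub.
  split=> [|u v]; rewrite !inE.
    by exists 1; split=> // g; rewrite ?invg1 mul1g.
  move=> [a [<- aP aP']] [b [<- bP bP']]; exists (a * b^-1); split=> //.
  - by move=> g Pg; rewrite -mulgA; exact/aP/bP'.
  - by move=> g Pg; rewrite invgF -mulgA; exact/bP/aP'.
move=> u u3.
pose a : A := exist _ u (mem_set (sub_gen_smallest u3)).
have [U aU] := @alternating_is_three_cycle a u3.
exists a; split=> // g Pg; first exact: PM aU Pg.
exact: PM (three_cycleV aU) Pg.
Qed.

(** The source map restricted to T is injective and open, so cluster points lift.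
    The space of arrows need not be Hausdorff. *)
Lemma compact_lift T (B : set X) : open T -> {in T &, injective (src : G -> X)} ->
  compact B -> B `<=` src @` T -> compact (T `&` [set g : G | B (src g)]).
Proof.
move=> oT si kB BT F PF FR.
have FB : F [set g : G | B (src g)] by move: FR; apply: filterS => g [].
have [//|b [Bb clb]] := kB (src @ F) _.
have [h Th hb] := BT b Bb; exists h; split; first by split=> //=; rewrite hb.
move=> A O FA; rewrite nbhsE => -[O' [oO' O'h] O'O].
pose A' := A `&` (T `&` [set g : G | B (src g)]).
have FA' : F [set g : G | (src @` A') (src g)].
  have FI : F A' by exact: filterI.
  by move: FI; apply: filterS => a A'a; exists a.
have [||_ [[a [Aa [Ta _]] <-] [o [O'o To] e]]] := clb (src @` A') (src @` (O' `&` T)).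
- exact: FA'.
- apply: open_nbhs_nbhs; split; first exact: src_open (openI oO' oT).
  by exists h.
by exists a; split=> //; apply: O'O; rewrite -(si o a) ?inE.
Qed.

Context (hausX : hausdorff_space X).
Context (baseX : forall (O : set X) x, open O -> O x ->
  exists B, [/\ compact B, open B, B x & B `<=` O]).
Context (perfX : forall x : X, ~ open [set x]).
Context (Gmin : minimal_groupoid G).

Lemma alternating_cut (c : A) (U V : set X) : three_cycle to c U ->
  compact V -> open V -> V `<=` U -> exists c' : A, three_cycle to c' V /\ is_cut to c V c'.
Proof.
move=> cU kV oV VU; have [_ _ dU c3 _] := cU.
have cont := alternating_continuous.
pose S := cycle_support to c V.
have clV : closed V := compact_closed hausX kV.
have clS : closed S := cycle_support_closed cont clV.
have oS : open S := cycle_support_open cont c oV.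
have Sc x : S x -> S (to c x) by exact: cycle_support_act.
have fc := full_groupP (val c).
pose T := val (val c) `&` [set g : G | S (src g)].
have rngT g : T g -> rng g = to c (src g).
  by move=> [cg _]; rewrite /= /alternating_act (tau_src fc cg).
have fT : full_bisection (with_units T S).
  apply: with_units_full => //.
  - apply: openI; last exact: src_open_preim.
    by case: fc => -[].
  - move=> g Tg; rewrite (rngT g Tg); case: Tg => _ Sg.
    by split=> //; exact: Sc.
  - by move=> x Sx; have [g cg gx] := full_arrow x fc; exists g => //; split; rewrite //= gx.
  - move=> x Sx; have [g cg gx] := full_arrow (to c (to c x)) fc.
    have Sg : S (src g) by rewrite gx; exact/Sc/Sc.
    by exists g; [split|rewrite rngT// gx c3].
  - move=> g h; rewrite !inE => -[cg _] [ch _]; exact: full_src_inj fc cg ch.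
  - move=> g h; rewrite !inE => -[cg _] [ch _]; exact: full_rng_inj fc cg ch.
pose u := full_of fT.
have u1 x : S x -> tau (val u) x = to c x.
  move=> Sx; have [g cg gx] := full_arrow x fc.
  have Tg : T g by split; rewrite //= gx.
  by rewrite (tau_src fT (g := g)) ?rngT ?gx//; left.
have u2 x : ~ S x -> tau (val u) x = x by move=> nS; exact: with_units_tau.
have [c' [c'u c'V]] : exists a : A, val a = u /\ three_cycle to a V.
  have V_S x : V x -> S x by constructor 1.
  apply: alternating_of => //.
  - by move=> x Vx; rewrite u1; [move=> /VU; apply: dU; exact: VU|exact: V_S].
  - move=> x; have [Sx|nS] := pselect (S x); last by rewrite !u2.
    by rewrite (u1 _ Sx) (u1 _ (Sc _ Sx)) (u1 _ (Sc _ (Sc _ Sx))).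
  - move=> x; have [Sx|nS] := pselect (S x); last by rewrite u2.
    rewrite (u1 x)// (u1 (to c x)); last exact: Sc.
    by case: Sx.
by exists c'; split=> //; split=> x Sx; rewrite -[to c' x]/(tau (val (val c')) x) c'u;
  [exact: u1|exact: u2].
Qed.

(** Choose an arrow k from rng g to a third point of the orbit, by minimality.
    Bisections R1 and R2 through g and k, restricted so that the range of R1 is the
    source of R2 and that src R1, rng R1 and rng R2 are disjoint, define two swaps;
    their product is a 3-cycle.  Using swaps avoids building a bisection of
    products of arrows. *)
Lemma alternating_arrow (g : G) (s : seq X) : src g <> rng g ->
  src g \notin s -> rng g \notin s -> exists (c : A) (U : set X),
    [/\ three_cycle to c U, val (val c) g & forall y, y \in s -> to c y = y].
Proof.
move=> xy xs ys; set x := src g in xy xs *; set y := rng g in xy ys *.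
have [_ [[k /= ky <-]]] : (groupoid_orbit G y `&` [set z | setT z /\ z \notin x :: y :: s]) !=set0.
  rewrite setIC; apply: Gmin; last exact: (open_minus hausX _ openT).
  by apply: (open_minus_ne hausX perfX _ openT); exists x.
move=> [_]; set w := rng k; rewrite !inE !negb_or => /and3P[/eqP wx /eqP wy ws].
have [N [oN Nx N0]] := separate hausX [:: x, y, w & s].
pose N' z := [set z' | N z z' /\ z' \notin s].
have oN' z : open (N' z) by exact: (open_minus hausX).
have N'0 a b z : a \in [:: x; y; w] -> b \in [:: x; y; w] -> a <> b -> N' a z -> N' b z -> False.
  move=> ha hb ab [Na _] [Nb _]; apply: (N0 a b z _ _ ab Na Nb).
    by move: ha; rewrite !inE => /or3P[] /eqP ->; rewrite eqxx ?orbT.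
  by move: hb; rewrite !inE => /or3P[] /eqP ->; rewrite eqxx ?orbT.
have [S1 [oS1 S1g si1 ri1]] := local_bisection g.
have [S2 [oS2 S2k si2 ri2]] := local_bisection k.
pose T2 := S2 `&` ([set h : G | N' y (src h)] `&` [set h : G | N' w (rng h)]).
have oT2 : open T2.
  by apply: openI => //; apply: openI; [exact: src_open_preim|exact: rng_open_preim].
have T2k : T2 k by split=> //; split; rewrite /= ?ky.
pose T1 := S1 `&` ([set h : G | N' x (src h)] `&` [set h : G | (src @` T2) (rng h)]).
have oT1 : open T1.
  apply: openI => //; apply: openI; first exact: src_open_preim.
  by apply: rng_open_preim; exact: src_open.
have T1g : T1 g by split=> //; split => //=; exists k.
have [B [kB oB Bx BT]] : exists B, [/\ compact B, open B, B x & B `<=` src @` T1].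
  by apply: baseX; [exact: src_open|exists g].
pose R1 := T1 `&` [set h : G | B (src h)].
have oR1 : open R1 by apply: openI => //; exact: src_open_preim.
have R1g : R1 g by [].
pose R2 := T2 `&` [set h : G | (rng @` R1) (src h)].
have oR2 : open R2 by apply: openI => //; apply: src_open_preim; exact: rng_open.
have R2k : R2 k by split=> //=; exists g => //; rewrite ky.
have sR1 : src @` R1 = B.
  apply/seteqP; split=> [_ [h [_ Bh] <-]//|z Bz].
  by have [h Th hz] := BT _ Bz; exists h => //; split; rewrite //= hz.
have sR2 : src @` R2 = rng @` R1.
  apply/seteqP; split=> [_ [h [_ Rh] <-]//|_ [h Rh <-]].
  have [T1h _] := Rh; case: T1h => _ [_ [h' T2h' e]].
  by exists h' => //; split=> //=; exists h.
have compR (R : set G) : compact R -> closed (rng @` R).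
  move=> kR; apply: (compact_closed hausX); apply: continuous_compact => //.
  exact/continuous_subspaceT/rng_continuous.
have sT1 : {in T1 &, injective (src : G -> X)}.
  by move=> a b; rewrite !inE => -[Sa _] [Sb _]; apply: si1; rewrite inE.
have kR1 : compact R1 by exact: compact_lift.
have crR1 := compR _ kR1.
have kR2 : compact R2.
  apply: compact_lift => //.
  - by move=> a b; rewrite !inE => -[Sa _] [Sb _]; apply: si2; rewrite inE.
  - by apply: continuous_compact => //; exact/continuous_subspaceT/rng_continuous.
  - by rewrite -sR2 => _ [h [Th _] <-]; exists h.
have crR2 := compR _ kR2.
have R1x h : R1 h -> N' x (src h) by case=> -[_ [? _]].
have R1y h : R1 h -> N' y (rng h) by case=> -[_ [_ [h' [_ [? _]] <-]]].
have R2y h : R2 h -> N' y (src h) by case=> -[_ [? _]].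
have R2w h : R2 h -> N' w (rng h) by case=> -[_ [_ ?]].
have dxy z : N' x z -> N' y z -> False by apply: N'0; rewrite ?inE ?eqxx ?orbT.
have dxw z : N' x z -> N' w z -> False.
  by apply: N'0; rewrite ?inE ?eqxx ?orbT//; exact: nesym.
have dyw z : N' y z -> N' w z -> False.
  by apply: N'0; rewrite ?inE ?eqxx ?orbT//; exact: nesym.
have [||||||u1 [u1R u1s u1r u1f _]] := @swap_exists R1 => //.
- by move=> a b; rewrite !inE => -[Ta _] [Tb _]; apply: sT1; rewrite inE.
- by move=> a b; rewrite !inE => -[[Sa _] _] [[Sb _] _]; apply: ri1; rewrite inE.
- by rewrite sR1; exact: (compact_closed hausX).
- by move=> a b Ra Rb e; apply: (dxy (src a)); [exact: R1x|rewrite e; exact: R1y].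
have [||||||u2 [u2R u2s u2r u2f u2u]] := @swap_exists R2 => //.
- by move=> a b; rewrite !inE => -[[Sa _] _] [[Sb _] _]; apply: si2; rewrite inE.
- by move=> a b; rewrite !inE => -[[Sa _] _] [[Sb _] _]; apply: ri2; rewrite inE.
- by rewrite sR2.
- by move=> a b Ra Rb e; apply: (dyw (src a)); [exact: R2y|rewrite e; exact: R2w].
have Bx' z : B z -> N' x z by rewrite -sR1 => -[h Rh <-]; exact: R1x.
have offx z : N' x z -> ~ (src @` R2) z /\ ~ (rng @` R2) z.
  move=> xz; split=> -[h Rh e]; first by apply: (dxy z) => //; rewrite -e; exact: R2y.
  by apply: (dxw z) => //; rewrite -e; exact: R2w.
have offw z : N' w z -> ~ (src @` R1) z /\ ~ (rng @` R1) z.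
  move=> wz; split=> -[h Rh e]; first by apply: (dxw z) => //; rewrite -e; exact: R1x.
  by apply: (dyw z) => //; rewrite -e; exact: R1y.
pose u := u1 * u2.
have uB h : R1 h -> tau (val u) (src h) = rng h.
  by move=> Rh; rewrite tauM u2f ?u1s//; have [] := offx _ (R1x _ Rh).
have uC h : R2 h -> tau (val u) (src h) = rng h.
  by move=> Rh; rewrite tauM u2s// u1f//; have [] := offw _ (R2w _ Rh).
have uD h h' : R1 h -> R2 h' -> src h' = rng h -> tau (val u) (rng h') = src h.
  by move=> Rh Rh' e; rewrite tauM u2r// e u1r.
have cycle h : R1 h -> exists h', [/\ R2 h', src h' = rng h,
    tau (val u) (src h) = rng h, tau (val u) (rng h) = rng h' & tau (val u) (rng h') = src h].
  move=> Rh; have [h' Rh' e] : (src @` R2) (rng h) by rewrite sR2; exists h.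
  by exists h'; split=> //; [exact: uB|rewrite -e; exact: uC|exact: uD].
have cycle' h' : R2 h' -> exists h, [/\ R1 h, src h' = rng h,
    tau (val u) (src h) = rng h, tau (val u) (rng h) = rng h' & tau (val u) (rng h') = src h].
  move=> Rh'; have [h Rh e] : (rng @` R1) (src h') by rewrite -sR2; exists h'.
  by exists h; split=> //; [exact: uB|rewrite e; exact: uC|exact: uD].
have ufix z : ~ B z -> ~ (rng @` R1) z -> ~ (rng @` R2) z -> tau (val u) z = z.
  by move=> n1 n2 n3; rewrite tauM u2f ?sR2// u1f// sR1.
have u1z z : B z -> exists2 h, R1 h & src h = z by rewrite -sR1 => -[h]; exists h.
have BR1 h : R1 h -> B (src h) by case.
have [a [au aB]] : exists a : A, val a = u /\ three_cycle to a B.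
  apply: alternating_of => //.
  - move=> z /u1z[h Rh <-]; rewrite uB// => /Bx' xz; exact: (dxy _ xz (R1y _ Rh)).
  - move=> z; have [/u1z[h Rh <-]|n1] := pselect (B z).
      by have [h' [_ _ -> -> ->]] := cycle h Rh.
    have [[h Rh <-]|n2] := pselect ((rng @` R1) z).
      by have [h' [_ _ e -> ->]] := cycle h Rh.
    have [[h' Rh' <-]|n3] := pselect ((rng @` R2) z).
      by have [h [_ _ e1 e2 ->]] := cycle' h' Rh'; rewrite e1 e2.
    by rewrite !ufix.
  - move=> z n1 n2 n3; apply: ufix => //.
      move=> [h Rh hz]; apply: n3; have [h' [_ _ _ e1 e2]] := cycle h Rh.
      by rewrite -hz e1 e2; exact: BR1.
    move=> [h' Rh' hz]; apply: n2; have [h [Rh _ _ _ e2]] := cycle' h' Rh'.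
    by rewrite -hz e2; exact: BR1.
exists a, B; split=> //.
- rewrite au /=; exists g, (gunit G x); rewrite rng_unit.
  split=> //; [exact: u1R| |exact/esym/gmul1].
  by have [n1 n2] := offx x (Bx' x Bx); exact: u2u.
- move=> z zs; change (tau (val (val a)) z = z); rewrite au; apply: ufix.
  + by move=> /Bx'[_]; rewrite zs.
  + by move=> [h /R1y[_ hs] hz]; rewrite hz zs in hs.
  + by move=> [h /R2w[_ hs] hz]; rewrite hz zs in hs.
Qed.

Lemma alternating_rich : rich_action to.
Proof.
split=> //.
- exact: alternating_continuous.
- exact: alternating_faithful.
- exact: alternating_ind.
- exact: alternating_cut.
- move=> x s W oW W0 xs nWx.
  have [_ [[g /= gx <-] [Wg]]] : (groupoid_orbit G x `&` [set z | W z /\ z \notin x :: s]) !=set0.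
    rewrite setIC; apply: Gmin; last exact: (open_minus hausX _ oW).
    exact: (open_minus_ne hausX perfX _ oW).
  rewrite inE negb_or => /andP[/eqP gx' gs].
  have [|||c [U [cU cg cs]]] := @alternating_arrow g s; rewrite ?gx//.
    exact: nesym.
  exists c, U; split=> //.
  change (W (tau (val (val c)) x)).
  by rewrite (tau_src (full_groupP _) cg gx).
- move=> a x s ax xs axs.
  have [g ag gx] := full_arrow x (full_groupP (val a)).
  have ga : rng g = to a x.
    change (rng g = tau (val (val a)) x).
    by rewrite (tau_src (full_groupP _) ag gx).
  have [|||c [U [cU cg cs]]] := @alternating_arrow g s; rewrite ?gx ?ga//.
    exact: nesym.
  exists c, U; split=> //.
  have [[[oc _ _] _ _] [[oa _ _] _ _]] := (full_groupP (val c), full_groupP (val a)).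
  have : nbhs x (src @` (val (val c) `&` val (val a))).
    apply: open_nbhs_nbhs; split; first exact: src_open (openI oc oa).
    by exists g.
  apply: filterS => _ [h [ch ah] <-].
  change (tau (val (val c)) (src h) = tau (val (val a)) (src h)).
  by rewrite (tau_src (full_groupP _) ch) // (tau_src (full_groupP _) ah).
Qed.

End FullGroup.

(** * The space of subgroups *)

Lemma compact_directed (T : topologicalType) (I : Type) (D : I -> set T)
    (i0 : I) (meet : I -> I -> I) : compact [set: T] ->
  (forall i, D i !=set0) -> (forall i j, D (meet i j) `<=` D i `&` D j) ->
  exists x, forall i, closure (D i) x.
Proof.
move=> kT D0 DI.
have FF : Filter (filter_from [set: I] D).
  apply: filter_from_filter; first by exists i0.
  by move=> i j _ _; exists (meet i j).
have PF : ProperFilter (filter_from [set: I] D) by apply: filter_from_proper => i _.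
have [|x [_ clx]] := kT _ PF; first by exists i0.
exists x => i B nB; apply: clx => //; by exists i.
Qed.

Section Chabauty.
Context {gT : groupType}.
Notation Sub := (subgroup_space gT).
Implicit Types (H K : Sub) (a b : gT) (s : seq gT).

Definition mem_sub K : gT -> Prop := fun a => (val K : gT -> bool) a.

Lemma sub_subgroup K : is_subgroup (mem_sub K).
Proof.
have [K1 KD] : group_closed (val K : pred gT) := set_mem (valP K).
by split=> // a b Ka Kb; exact: KD.
Qed.

Lemma sub_eq K K' : (forall a, mem_sub K a <-> mem_sub K' a) -> K = K'.
Proof.
move=> e; apply: val_inj; apply/funext => a; apply/idP/idP; exact: (e a).1 || exact: (e a).2.
Qed.

Definition agree s K K' := forall a, a \in s -> mem_sub K a <-> mem_sub K' a.

(** The subsets of the group that agree with K on a given finite set form a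
    filter base that converges to K for pointwise convergence. *)
Lemma nbhs_agree K (O : set Sub) : nbhs K O -> exists s, [set K' | agree s K' K] `<=` O.
Proof.
rewrite nbhsE => -[_ [[W oW <-] WK] WO].
pose B s := [set f : prod_topology (fun _ : gT => bool) |
  forall a, a \in s -> f a = (val K : prod_topology (fun _ : gT => bool)) a].
have FB : Filter (filter_from [set: seq gT] B).
  apply: filter_from_filter; first by exists [::].
  move=> s t _ _; exists (s ++ t) => // f fst.
  by split=> a ast; apply: fst; rewrite mem_cat ast ?orbT.
have cvgB : filter_from [set: seq gT] B --> (val K : prod_topology (fun _ : gT => bool)).
  apply/cvg_sup => a.
  have surj : (fun f : gT -> bool => f a) @` setT = setT.
    by apply/seteqP; split=> // b _; exists (fun=> b).
  apply/cvg_image => // D nD; exists ((fun f : gT -> bool => f a) @^-1` D).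
    exists [:: a] => // f /(_ a (mem_head _ _)) fa; rewrite /= fa.
    exact: nbhs_singleton nD.
  exact: image_preimage.
have [s _ sW] : filter_from [set: seq gT] B W by apply: cvgB; exact: open_nbhs_nbhs.
exists s => K' KK'; apply: WO; apply: sW => a /KK'[h1 h2].
by apply/idP/idP.
Qed.

Lemma agree_open s K : open [set K' | agree s K' K].
Proof.
apply: (open_forall (F := fun a => [set K' : Sub | mem_sub K' a <-> mem_sub K a])) => a _.
have ca : continuous (fun K' : Sub => (val K' : gT -> bool) a).
  move=> K'; apply: (@continuous_comp _ _ _ (set_val : Sub -> prod_topology (fun _ : gT => bool))
    (fun f => f a)); first exact: initial_continuous.
  exact: (@proj_continuous gT (fun _ => bool) a).
rewrite (_ : [set _ | _] = (fun K' : Sub => (val K' : gT -> bool) a) @^-1` [set (val K : gT -> bool) a]).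
  by apply: open_comp => [K' _|]; [exact: ca|exact: discrete_open].
apply/seteqP; split=> K' /=; first by move=> [h1 h2]; apply/idP/idP.
by move=> e; have -> : mem_sub K' a = mem_sub K a by congr is_true; exact: e.
Qed.

Lemma closure_agree (D : set Sub) K :
  closure D K <-> forall s, exists2 K', D K' & agree s K' K.
Proof.
split=> [clK s|DK].
  have [|K' [DK' ?]] := clK [set K' | agree s K' K]; last by exists K'.
  by apply: open_nbhs_nbhs; split; [exact: agree_open|].
by move=> O /nbhs_agree[s sO]; have [K' DK' /sO] := DK s; exists K'.
Qed.

(** An ultrafilter converges to the subgroup of the elements contained in
    almost every subgroup. *)
Lemma Sub_compact : compact [set: Sub].
Proof.
rewrite compact_ultra => F FU _.
pose P a := F [set K : Sub | mem_sub K a].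
have P1 : P 1 by rewrite /P (_ : [set _ | _] = setT); [exact: filterT|
  apply/seteqP; split=> // K _; exact: (subgroup1 (sub_subgroup K))].
have PD a b : P a -> P b -> P (a * b^-1).
  by apply: filterS2 => K; exact: (sub_subgroup K).2.
have gP : group_closed (fun a => `[< P a >] : bool).
  split=> [|a b]; rewrite !unfold_in; first exact/asboolP.
  by move=> /asboolP Pa /asboolP Pb; apply/asboolP; exact: PD.
pose K0 : Sub := subgroup_of gP.
exists K0; split=> // O /nbhs_agree[s sO].
suff : F [set K' | agree s K' K0] by apply: filterS.
elim: s {sO} => [|a s IH].
  by rewrite (_ : [set _ | _] = setT); [exact: filterT|apply/seteqP; split].
have Fa : F [set K' : Sub | mem_sub K' a <-> mem_sub K0 a].
  have [Pa|Pa] := in_ultra_setVsetC [set K : Sub | mem_sub K a] FU.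
    by move: (Pa); apply: filterS => K' Ka; split=> // _; apply/asboolP.
  have nPa : ~ P a by move=> /(filterI Pa); rewrite setICl; exact: filter_not_empty.
  by move: (Pa); apply: filterS => K' Ka; split=> // /asboolP.
move: Fa IH; apply: filterS2 => K' Ka Ks b; rewrite inE => /predU1P[->//|]; exact: Ks.
Qed.

Lemma mem_conj a K b : mem_sub (subgroup_conj a K) b = mem_sub K (b ^ a).
Proof. by []. Qed.

End Chabauty.

(** * Uniformly recurrent subgroups *)

Section URS.
Context {gT : groupType}.
Notation Sub := (subgroup_space gT).
Implicit Types (H K : Sub) (V : set Sub).

Lemma mem_trivial a : mem_sub (subgroup_trivial (gT := gT)) a <-> a = 1.
Proof. by split=> [/eqP//|->]; exact: eqxx. Qed.

(** A fixed point of the conjugation action is a closed invariant set. *)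
Lemma URS_singleton K V : (forall a, subgroup_conj a K = K) -> is_URS V -> V K ->
  V = [set K].
Proof.
move=> invK [_ _ _ minV] VK; symmetry; apply: minV.
- move=> K' /closure_agree cl; apply: sub_eq => a.
  by have [_ -> /(_ a (mem_head _ _)) e] := cl [:: a]; split=> /e.
- by exists K.
- by move=> a _ ->; rewrite invK.
- by move=> _ ->.
Qed.

Lemma URS_whole V : is_URS V -> V (subgroup_whole (gT := gT)) -> trivial_URS V.
Proof. by move=> uV Vw; right; apply: URS_singleton => // a; exact: sub_eq. Qed.

(** The trivial subgroup is outside the closed set V, which is witnessed by a finite
    trace. *)
Lemma URS_confined V H : is_URS V -> ~ trivial_URS V -> V H ->
  exists P : seq gT, (forall p, p \in P -> p <> 1) /\
    forall c, exists2 p, p \in P & mem_sub H (c * p * c^-1).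
Proof.
move=> uV ntV VH; have [cV _ invV _] := uV.
have : ~ closure V (subgroup_trivial (gT := gT)).
  move=> /cV Vt; apply: ntV; left; apply: URS_singleton => // a.
  apply: sub_eq => b; rewrite mem_conj; split=> /mem_trivial b1; apply/mem_trivial.
    by apply/eqP; rewrite -(conjg_eq1 b a) b1.
  by rewrite b1 conj1g.
move=> /closure_agree/existsNP[s sV].
exists [seq a <- s | a != 1]; split=> [p|c]; first by rewrite mem_filter => /andP[/eqP].
apply: contrapT => no; apply: sV; exists (subgroup_conj c^-1 H); first exact: invV.
move=> a as_; rewrite mem_conj; split=> [Ha|].
  apply/mem_trivial/eqP; apply: contrapT => /negP a1.
  apply: no; exists a; first by rewrite mem_filter a1.
  by move: Ha; rewrite conjgE invgK mulgA.
move=> /mem_trivial ->; rewrite conj1g.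
exact: subgroup1 (sub_subgroup H).
Qed.

End URS.

Section RichURS.
Context {gT : groupType} {X : topologicalType} {to : group_action gT X}.
Context (HA : rich_action to).
Notation Sub := (subgroup_space gT).
Implicit Types (H K : Sub) (V : set Sub) (a b c g : gT) (x y : X) (s : seq gT).

Let act_cont := ra_cont HA.
Notation germ_eq := (germ_eq to).
Notation is_cycle := (@is_cycle _ _ to).

Lemma germ_open a b x : germ_eq a b x ->
  exists O : set X, [/\ open O, O x & forall y, O y -> to a y = to b y].
Proof.
move=> ab; have : nbhs x [set y | to a y = to b y] := ab.
by rewrite nbhsE => -[O [oO Ox] sub]; exists O.
Qed.

(** K is a limit of conjugates of a member H of V by elements that move the
    exceptional set of H into N i. *)
Lemma URS_directed V (I : Type) (N : I -> set X) (i0 : I) (meet : I -> I -> I) :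
  is_URS V -> ~ trivial_URS V -> (forall i, open (N i)) -> (forall i, N i !=set0) ->
  (forall i j, N (meet i j) `<=` N i `&` N j) ->
  exists2 K, V K & forall i c, is_cycle c -> (forall x, N i x -> to c x = x) -> mem_sub K c.
Proof.
move=> uV ntV oN N0 NI; have [cV [H VH] invV _] := uV.
have [P [P1 conf]] := URS_confined uV ntV VH.
have HH := sub_subgroup H.
have [Q goodQ] := finite_exceptional HA HH P1 conf.
pose D i := [set K | exists2 g, forall q, q \in Q -> N i (to g q) & K = subgroup_conj g H].
have [||K clK] := @compact_directed _ _ D i0 meet (@Sub_compact gT).
- by move=> i; have [g gQ] := gather HA Q (oN i) (N0 i); exists (subgroup_conj g H), g.
- by move=> i j _ [g gQ ->]; split; exists g => // q /gQ /NI[].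
exists K.
  apply: cV; have := clK i0; apply: closure_subset => _ [g _ ->]; exact: invV.
move=> i c ic cN; have [_ [g gQ ->]] := (closure_agree (D i) K).1 (clK i) [:: c].
move=> /(_ c (mem_head _ _))[+ _]; apply; rewrite mem_conj.
apply: (good_cyc_off HA HH goodQ).
  by rewrite conjgE mulgA -{2}[g]invgK; exact: (is_cycleJ HA).
by move=> q /gQ gq; rewrite conjgE !group_actM cN// actK.
Qed.

(** The group of the elements with trivial germ at x is the smallest possible
    limit of stabilisers of points converging to x, and the stabiliser of x is the
    largest one. *)
Definition over K x :=
  (forall a, germ_eq a 1 x -> mem_sub K a) /\ (forall a, mem_sub K a -> to a x = x).

Definition nbhd x := {O : set X | open O /\ O x}.

Definition nbhdT x : nbhd x := exist _ setT (conj openT I).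

Definition nbhdI x (O O' : nbhd x) : nbhd x :=
  exist _ (sval O `&` sval O') (conj (openI (svalP O).1 (svalP O').1)
    (conj (svalP O).2 (svalP O').2)).

(** Here the exceptional set is pushed to x.  If K contained an element moving x it
    would be the whole group, and V would be trivial. *)
Lemma URS_over V x : is_URS V -> ~ trivial_URS V -> exists2 K, V K & over K x.
Proof.
move=> uV ntV.
have [|||K VK KP] := @URS_directed V (nbhd x) (fun O => sval O) (nbhdT x) (@nbhdI x) uV ntV.
- by move=> O; have [] := svalP O.
- by move=> O; exists x; have [] := svalP O.
- by move=> O O'.
have Koff c : is_cycle c -> to c x = x -> mem_sub K c.
  move=> ic cx; have [O [oO Ox cO]] := germ_open (is_cycle_fix_germ HA ic cx).
  apply: (KP (exist _ O (conj oO Ox))) => // y /cO; by rewrite /= group_act1.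
exists K => //; split=> [a /(cycles_off_of_germ HA)|k Kk].
  apply: cycles_off_ind; [exact: subgroup1 (sub_subgroup K)|exact: (sub_subgroup K).2|exact: Koff].
apply: contrapT => kx; apply: ntV; apply: URS_whole => //.
suff <- : K = subgroup_whole (gT := gT) by [].
apply: sub_eq => a; split=> // _.
exact: (subgroup_off_whole HA (sub_subgroup K) Koff Kk kx).
Qed.

(** Here the exceptional set is pushed outside every compact set, in particular
    off the support of every 3-cycle. *)
Lemma noncompact_no_URS : ~ compact [set: X] ->
  ~ exists V : set Sub, is_URS V /\ ~ trivial_URS V.
Proof.
move=> ncX [V [uV ntV]].
pose I := {C : set X | compact C}.
have [|||K VK KP] := @URS_directed V I (fun C => ~` sval C) (exist _ set0 compact0)
  (fun C C' => exist _ (sval C `|` sval C') (compactU (svalP C) (svalP C'))) uV ntV.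
- by move=> [C kC]; apply: closed_openC; exact: (closed_compact HA).
- move=> [C kC] /=; apply: contrapT => no; apply: ncX.
  suff <- : C = setT by [].
  by apply/seteqP; split=> // x _; apply: contrapT => nC; apply: no; exists x.
- by move=> [C kC] [C' kC'] x /= nx; split=> Cx; apply: nx; [left|right].
apply: ntV; apply: URS_whole => //.
suff <- : K = subgroup_whole (gT := gT) by [].
apply: sub_eq => a; split=> // _; move: a; apply: (ra_ind HA).
  exact: subgroup1 (sub_subgroup K).
move=> c U g cU Kg; apply: (subgroupM (sub_subgroup K)) => //.
have kS : compact (cycle_support to c U) by case: cU => kU _ _ _ _; exact: (cycle_support_compact act_cont).
by apply: (KP (exist _ _ kS)) => [|x nx]; [exists U|exact: three_cycle_fix cU nx].
Qed.

(** Excluded are the boundary points of the fixed point set of a. *)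
Definition regular a x := to a x <> x \/ germ_eq a 1 x.

Lemma regular_open_dense s (W : set X) : open W -> W !=set0 ->
  exists W', [/\ open W', W' !=set0, W' `<=` W & forall x a, W' x -> a \in s -> regular a x].
Proof.
elim: s W => [|a s IH] W oW W0; first by exists W; split=> // x a _; rewrite in_nil.
have [[x [Wx ax]]|fixW] := pselect (exists x, W x /\ to a x <> x).
  have [||W' [oW' W'0 W'W reg]] := IH (W `&` [set x | to a x <> x]).
  - by apply: openI => //; exact: (open_moved HA _).
  - by exists x.
  exists W'; split=> // [y /W'W[]//|y b W'y]; rewrite inE => /predU1P[->|]; last exact: reg.
  by left; have [] := W'W _ W'y.
have [W' [oW' W'0 W'W reg]] := IH W oW W0.
exists W'; split=> // y b W'y; rewrite inE => /predU1P[->|]; last exact: reg.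
right; have : nbhs y W by apply: open_nbhs_nbhs; split=> //; exact: W'W.
apply: filterS => z Wz; rewrite group_act1; apply: contrapT => az.
by apply: fixW; exists z.
Qed.

Lemma regular_exists s : [set: X] !=set0 -> exists x, forall a, a \in s -> regular a x.
Proof.
move=> X0; have [W' [_ [x W'x] _ reg]] := regular_open_dense s openT X0.
by exists x => a; exact: reg.
Qed.

Lemma regularJ a g x : regular (a ^ g) x -> regular a (to g x).
Proof.
case=> [agx|ag1]; [left|right].
  by move=> e; apply: agx; rewrite conjgE !group_actM e actK.
have : germ_eq (g * (a ^ g * g^-1)) (g * (1 * g^-1)) (to g x).
  by apply/germ_mulr/(germ_mull act_cont); rewrite actK.
by rewrite mul1g mulgV conjgE -!mulgA mulgV mulg1 mulVKg.
Qed.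

Lemma mem_stabiliser x a : mem_sub (stabiliser to x) a <-> to a x = x.
Proof. by split=> [/asboolP|] // ax; apply/asboolP. Qed.

(** The intersection, over the finite sets s, of the closures of the sets of
    stabilisers of the points that are regular for all elements of s, spelled out
    in terms of traces. *)
Definition generic_stabilisers : set Sub := [set K | forall s, exists x,
  forall a, a \in s -> regular a x /\ (mem_sub K a <-> to a x = x)].
Notation U := generic_stabilisers.

Lemma generic_nonempty : [set: X] !=set0 -> U !=set0.
Proof.
move=> X0; pose D s := [set stabiliser to x | x in [set x | forall a, a \in s -> regular a x]].
have [||K clK] := @compact_directed _ _ D [::] (@cat gT) (@Sub_compact gT).
- by move=> s; have [x xs] := regular_exists s X0; exists (stabiliser to x), x.
- by move=> s t _ [x xst <-]; split; exists x => // a ast; apply: xst;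
    rewrite mem_cat ast ?orbT.
exists K => s; have [_ [x xs <-] ag] := (closure_agree (D s) K).1 (clK s) s.
exists x => a as_; split; first exact: xs.
by split=> [/(ag a as_)/mem_stabiliser|/mem_stabiliser/(ag a as_)].
Qed.

Lemma generic_closed : closed U.
Proof.
move=> K /closure_agree cl s; have [K' UK' ag] := cl s.
have [x xP] := UK' s; exists x => a as_; have [reg e] := xP a as_; split=> //.
by split=> [/(ag a as_)/e|/e/(ag a as_)].
Qed.

Lemma generic_conj : conj_invariant U.
Proof.
move=> g K UK s; have [x xP] := UK [seq a ^ g | a <- s].
exists (to g x) => a as_; have [reg e] := xP _ (map_f (fun a => a ^ g) as_).
split; first exact: regularJ.
rewrite mem_conj; split=> [/e|ag]; first by rewrite conjgE !group_actM => {2}<-; rewrite actKV.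
by apply/e; rewrite conjgE !group_actM ag actK.
Qed.

Lemma generic_closure : U `<=` closure (range (stabiliser to)).
Proof.
move=> K UK; apply/closure_agree => s; have [x xP] := UK s.
exists (stabiliser to x); first by exists x.
by move=> a /xP[_ e]; split=> [/mem_stabiliser/e|/e/mem_stabiliser].
Qed.

(** At a point x that is regular for s, all the subgroups between the germ
    stabiliser and the stabiliser of x have the same trace on s. *)
Lemma generic_sub V : closed V -> (forall x, exists2 K, V K & over K x) -> U `<=` V.
Proof.
move=> cV Vover K UK; apply: cV; apply/closure_agree => s.
have [x xP] := UK s; have [K' VK' [lo up]] := Vover x; exists K' => // a /xP[reg e].
split=> [/up/e//|/e ax]; apply: lo; by case: reg.
Qed.

(** If stabilisers of points converge to K, then K lies over every cluster point of
    these points. *)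
Lemma closure_over K : compact [set: X] -> closure (range (stabiliser to)) K ->
  exists x, over K x.
Proof.
move=> kX /closure_agree clK.
pose D s := [set x | agree s (stabiliser to x) K].
have [||x clx] := @compact_directed _ _ D [::] (@cat gT) kX.
- by move=> s; have [_ [x _ <-] ?] := clK s; exists x.
- by move=> s t x xst; split=> a ast; apply: xst; rewrite mem_cat ast ?orbT.
exists x; split=> a.
  move=> /(clx [:: a])[y [/(_ a (mem_head _ _)) ag]]; rewrite group_act1 => ay.
  exact/ag/mem_stabiliser.
move=> Ka; apply: contrapT => ax.
have [|y [/(_ a (mem_head _ _)) ag ay]] := clx [:: a] [set y | to a y <> y].
  by apply: open_nbhs_nbhs; split=> //; exact: (open_moved HA _).
by apply/ay/mem_stabiliser/ag.
Qed.

(** A limit of conjugates of K by elements moving x0 to points that converge to x. *)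
Lemma over_transport V K x0 : closed V -> conj_invariant V -> V K -> over K x0 ->
  forall x, exists2 K', V K' & over K' x.
Proof.
move=> cV invV VK [lo up] x.
pose D (O : nbhd x) := [set K' | exists2 g, sval O (to g x0) & K' = subgroup_conj g K].
have [||K' clK'] := @compact_directed _ _ D (nbhdT x) (@nbhdI x) (@Sub_compact gT).
- move=> [O [oO Ox]]; have [|g gO] := gather HA [:: x0] oO _; first by exists x.
  by exists (subgroup_conj g K), g => //=; apply: gO; rewrite inE.
- by move=> O O' _ [g [gO gO'] ->]; split; exists g.
exists K'; first by apply: cV; have := clK' (nbhdT x); apply: closure_subset => _ [g _ ->]; exact: invV.
split=> a.
  move=> /germ_open[O [oO Ox aO]].
  have [_ [g gO ->] ] := (closure_agree _ _).1 (clK' (exist _ O (conj oO Ox))) [:: a].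
  move=> /(_ a (mem_head _ _))[+ _]; apply; rewrite mem_conj; apply: lo.
  have : germ_eq a 1 (to g x0).
    have : nbhs (to g x0) O by exact: open_nbhs_nbhs.
    by apply: filterS => y /aO.
  move=> /(germ_mull act_cont)/(germ_mulr g^-1).
  by rewrite mul1g mulVg conjgE.
move=> K'a; apply: contrapT => ax.
pose O : nbhd x := exist _ [set y | to a y <> y] (conj (open_moved HA a) ax).
have [_ [g /= gO ->] ] := (closure_agree _ _).1 (clK' O) [:: a].
move=> /(_ a (mem_head _ _))[_ /(_ K'a)]; rewrite mem_conj => /up e.
by apply: gO; move: e; rewrite conjgE !group_actM => {2}<-; rewrite actKV.
Qed.

Lemma generic_sub_closure V : compact [set: X] -> closed V -> V !=set0 ->
  conj_invariant V -> V `<=` closure (range (stabiliser to)) -> U `<=` V.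
Proof.
move=> kX cV [K VK] invV VC; have [x0 Kx0] := closure_over kX (VC K VK).
by apply: generic_sub => //; exact: over_transport VK Kx0.
Qed.

Lemma generic_URS : compact [set: X] -> [set: X] !=set0 -> is_URS U.
Proof.
move=> kX X0; split; [exact: generic_closed|exact: generic_nonempty|exact: generic_conj|].
move=> V cV V0 invV VU; apply/seteqP; split=> //.
by apply: generic_sub_closure => //; apply: subset_trans generic_closure.
Qed.

Lemma generic_stabiliser_URS : compact [set: X] -> [set: X] !=set0 ->
  is_stabiliser_URS to U.
Proof.
move=> kX X0; split; [exact: generic_URS|exact: generic_closure|].
move=> V [cV V0 invV minV] VC; symmetry; apply: minV.
- exact: generic_closed.
- exact: generic_nonempty.
- exact: generic_conj.
- exact: generic_sub_closure.
Qed.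

Lemma generic_nontrivial : compact [set: X] -> [set: X] !=set0 -> ~ trivial_URS U.
Proof.
move=> kX X0; have [K UK] := generic_nonempty X0.
have [x [lo up]] := closure_over kX (generic_closure UK).
have [//|c [ic _ cx]] := @move_away _ _ _ HA x [::] [::].
have cx' : to c x <> x by apply/eqP; move: cx; rewrite inE.
case=> UE; move: UK; rewrite UE => KE; last first.
  by apply/cx'/up; rewrite KE.
have [|d [id dx dy]] := @move_away _ _ _ HA (to c x) [:: x] [::].
  by rewrite inE; apply/eqP.
have : mem_sub K d by apply/lo/(is_cycle_fix_germ HA) => //; apply: dx; rewrite inE.
rewrite KE => /mem_trivial d1.
by move: dy; rewrite d1 group_act1 inE eqxx.
Qed.

Lemma URS_generic V : is_URS V -> ~ trivial_URS V -> [set: X] !=set0 -> V = U.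
Proof.
move=> uV ntV X0; have [cV _ invV minV] := uV; symmetry; apply: minV.
- exact: generic_closed.
- exact: generic_nonempty.
- exact: generic_conj.
- by apply: generic_sub => // x; exact: URS_over.
Qed.

End RichURS.

Theorem corollary6p5 (X : topologicalType) (G : etale_groupoid X)
    (Gmin : minimal_groupoid G) (Geff : effective_groupoid G) :
  (is_cantor_space X ->
     exists U : set (subgroup_space (alternating_group G)),
       [/\ is_stabiliser_URS (alternating_action G) U,
           ~ trivial_URS U &
           forall V : set (subgroup_space (alternating_group G)),
             is_URS V -> ~ trivial_URS V -> V = U]) /\
  (is_lc_noncompact_cantor_space X ->
     ~ exists V : set (subgroup_space (alternating_group G)),
         is_URS V /\ ~ trivial_URS V).
Proof.
have rich (f : X -> cantor_space) : continuous f -> injective f ->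
    (forall O, open O -> open (f @` O)) -> rich_action (alternating_action G).
  move=> cf fI oF; apply: (alternating_rich Geff (unit_space_hausdorff G)) => //.
  - exact: (embedded_base cf fI oF).
  - exact: (embedded_perfect oF).
split=> [cantorX|lcX].
  have X0 : [set: X] !=set0 by case: cantorX => f [h _]; exists (h (fun=> false)).
  have [kX [f [cf fI oF]]] := cantor_open_embedding cantorX.
  have HA := rich f cf fI oF.
  exists (@generic_stabilisers _ _ (alternating_action G)); split.
  - exact: (generic_stabiliser_URS HA).
  - exact: (generic_nontrivial HA).
  - by move=> V uV ntV; exact: (URS_generic HA).
have [nkX [f [cf fI oF]]] := lc_cantor_open_embedding lcX.
exact: (noncompact_no_URS (rich f cf fI oF)).
Qed.
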